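(* Consider the trust-aware $K$-armed bandit model described in the context, and let $\pi$ be the policy-maker's policy produced by the trust-aware UCB algorithm described in the context. There exist positive constants $C_1,C_2$, independent of $H$ and $K$, such that for every $K\ge2$ and every horizon $H\ge2$, $$\sup\ \mathbb{E}[\mathsf{reg}_H(\pi)] \le C_1\sqrt{KH\log(H)}+C_2K^4\log^2(H),$$ where the supremum is over all trust-aware bandit instances with $K$ arms (all reward distributions with rewards in $[0,1]$, all trust sets $\mathcal{T}\subset[K]$ containing at least one optimal arm, and all own policies $\pi^{\mathsf{own}}$).
   Context: Trust-aware multi-armed bandit. There are $K$ arms. Rewards $(R_h(1),\dots,R_h(K))_{h\ge1}$ are i.i.d. random vectors over time with entries in $[0,1]$; $r(k)=\mathbb{E}[R_1(k)]$ and $r^\star=\max_{k} r(k)$. An instance also specifies a trust set $\mathcal{T}\subset[K]$ (unknown to the policy-maker) containing at least one arm $k$ with $r(k)=r^\star$, and an own policy $\pi^{\mathsf{own}}=(\pi^{\mathsf{own}}_h)_{h\ge1}$ of distributions on $[K]$ (unknown to the policy-maker). At each time $h$: the policy-maker recommends $a_h^{\mathsf{pm}}$; $\chi_h\sim\mathsf{Bern}(t_h)$ is drawn independently (conditionally on the past) and $a_h^{\mathsf{own}}\sim\pi_h^{\mathsf{own}}$; the implementer pulls $a_h^{\mathsf{ac}}=a_h^{\mathsf{pm}}$ if $\chi_h=1$, else $a_h^{\mathsf{ac}}=a_h^{\mathsf{own}}$, and receives $R_h(a_h^{\mathsf{ac}})$. Trust: $t_h=\alpha_h/(\alpha_h+\beta_h)$,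 $\alpha_1=\beta_1=1$, $\alpha_h=\alpha_{h-1}+\mathbb{1}\{a^{\mathsf{pm}}_{h-1}\in\mathcal{T}\}$, $\beta_h=\beta_{h-1}+\mathbb{1}\{a^{\mathsf{pm}}_{h-1}\notin\mathcal{T}\}$ for $h\ge2$. The policy-maker observes only $(a_i^{\mathsf{ac}},R_i(a_i^{\mathsf{ac}}),\chi_i)_{i<h}$ before choosing at time $h$. Regret: $\mathsf{reg}_H(\pi)=\sum_{h=1}^H(r^\star-r(a_h^{\mathsf{ac}}))$. Trust-aware UCB algorithm (input $K$, $H$). Set $\widehat{\mathcal{T}}=\varnothing$, $m=30K^3\log(H)$ (an integer number of steps) and $H_0=2mK$. Stage 1: for $h=1,\dots,H_0$, recommend $a_h^{\mathsf{pm}}=k:=\lceil h/(2m)\rceil$ and observe $a_h^{\mathsf{ac}},R_h(a_h^{\mathsf{ac}}),\chi_h$. When $h=2mk$, compute $Y_k^{(1)}=\frac1m\sum_{i=1}^m\chi_{2m(k-1)+i}$ and $Y_k^{(2)}=\frac1m\sum_{i=m+1}^{2m}\chi_{2m(k-1)+i}$. If $k=1$: add arm $1$ to $\widehat{\mathcal{T}}$ if $Y_1^{(1)}+Y_1^{(2)}\ge1/2$. If $k>1$: add arm $k$ to $\widehat{\mathcal{T}}$ if $Y_k^{(2)}-Y_k^{(1)}\ge\lambda_k(\widehat{\mathcal{T}})$, where (with $\widehat{\mathcal{T}}$ the current set) $\lambda_k(\widehat{\mathcal{T}})=1/(5k)$ if $|\widehat{\mathcal{T}}|=0$, $=-1/(5k)$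 if $|\widehat{\mathcal{T}}|=k-1$, and $=0$ otherwise. Stage 2: set $N^{\mathsf{ac}}_{H_0+1}(a)=1$ and $\mathsf{UCB}_{H_0+1}(a)=1$ for all $a$. For $h=H_0+1,\dots,H$: recommend $a_h^{\mathsf{pm}}\in\arg\max_{a\in\widehat{\mathcal{T}}}\mathsf{UCB}_h(a)$ with ties broken uniformly at random; observe $a_h^{\mathsf{ac}},R_h(a_h^{\mathsf{ac}}),\chi_h$; update the quantities for arm $a_h^{\mathsf{ac}}$ via $N^{\mathsf{ac}}_s(a)=1\vee\sum_{i=H_0+1}^{s-1}\mathbb{1}\{a_i^{\mathsf{ac}}=a\}$ and $\mathsf{UCB}_s(a)=1\wedge\Big\{\frac{1}{N^{\mathsf{ac}}_s(a)}\sum_{i=H_0+1}^{s-1}R_i(a)\mathbb{1}\{a_i^{\mathsf{ac}}=a\}+2\sqrt{\log(H)/N^{\mathsf{ac}}_s(a)}\Big\}$ for $s>H_0+1$. *)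

(* Defs.v *)
From HB Require Import structures.
From mathcomp Require Import all_boot all_order all_algebra.
From mathcomp Require Import all_classical all_reals all_analysis.
Set Implicit Arguments. Unset Strict Implicit. Unset Printing Implicit Defensive.
Import Order.TTheory GRing.Theory Num.Theory.
Local Open Scope ring_scope.

(* Conventions.  Arms are handled internally by their 0-based index
   a : nat (paper's arm k is index k-1); time steps are 0-based
   (paper's time h is index h-1).
   An observation (what the policy-maker sees) is
     ((a_ac, R(a_ac)), chi) : nat * R * bool.
   A full step record (what the environment keeps) is
     (((a_pm, chi), a_ac), R(a_ac)) : nat * bool * nat * R.            *)

Definition m_len (R : realType) (K H : nat) : nat :=
  `|Num.ceil (30 * (K%:R) ^+ 3 * ln (H%:R) : R)|%N.

Definition chi_avg (R : realType) (obs : seq (nat * R * bool)) (m start : nat) : R :=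
  (m%:R)^-1 * \sum_(i < m) (((nth (0%N, 0, false) obs (start + i)).2 : nat)%:R).

(* Estimated trust set \hat T built at the end of Stage 1 (arm indices,
   0-based; index j corresponds to the paper's arm k = j+1). *)
Definition trust_est (R : realType) (K m : nat) (obs : seq (nat * R * bool)) : seq nat :=
  foldl (fun S j =>
     let y1 := chi_avg obs m (2 * m * j) in
     let y2 := chi_avg obs m (2 * m * j + m) in
     if j == 0%N then (if (2%:R)^-1 <= y1 + y2 then rcons S j else S)
     else
       let lam : R :=
         if size S == 0%N then (5 * (j.+1)%:R)^-1
         else if size S == j then - (5 * (j.+1)%:R)^-1 else 0 in
       if lam <= y2 - y1 then rcons S j else S) [::] (iota 0 K).

Definition n_ac (R : realType) (h0 : nat) (obs : seq (nat * R * bool)) (a : nat) : nat :=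
  maxn 1 (count (fun e => e.1.1 == a) (drop h0 obs)).

Definition rew_sum (R : realType) (h0 : nat) (obs : seq (nat * R * bool)) (a : nat) : R :=
  \sum_(e <- drop h0 obs | e.1.1 == a) e.1.2.

Definition ucb (R : realType) (H h0 : nat) (obs : seq (nat * R * bool)) (a : nat) : R :=
  Num.min 1 (rew_sum h0 obs a / (n_ac h0 obs a)%:R
             + 2 * Num.sqrt (ln (H%:R) / (n_ac h0 obs a)%:R)).

(* The trust-aware UCB policy: recommendation at the time step following
   the observed history [obs], using the auxiliary tie-breaking variable
   u (uniform on [0,1)); ties are broken uniformly among the maximizers,
   listed in increasing order.  Convention: if \hat T is empty, the
   argmax is taken over all arms. *)
Definition tucb_pm (R : realType) (K H : nat) (obs : seq (nat * R * bool)) (u : R) : nat :=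
  let m := m_len R K H in
  let h0 := (2 * m * K)%N in
  if (size obs < h0)%N then (size obs %/ (2 * m))%N
  else
    let S := trust_est K m obs in
    let cand := if S is [::] then iota 0 K else S in
    let mx := \big[Num.max/0]_(a <- cand) ucb H h0 obs a in
    let ties := [seq a <- cand | ucb H h0 obs a == mx] in
    nth 0%N ties (minn (Num.truncn (u * (size ties)%:R)) (size ties).-1).

(* The interaction with the implementer, driven by the realizations:
   rew h a : reward vector at time h, w h : uniform variable producing
   chi_h = 1{w h < t_h} (so chi_h ~ Bern(t_h) given the past),
   own h : implementer's own action, u h : tie-breaking variable. *)
Fixpoint trajectory (R : realType) (K H : nat) (inT : pred nat)
    (rew : nat -> nat -> R) (w u : nat -> R) (own : nat -> nat) (n : nat)
    : seq (nat * bool * nat * R) :=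
  match n with
  | 0%N => [::]
  | n'.+1 =>
    let tr := trajectory K H inT rew w u own n' in
    let obs := [seq ((e.1.2, e.2), e.1.1.2) | e <- tr] in
    let apm := tucb_pm K H obs (u n') in
    let al := (1 + count (fun e => inT e.1.1.1) tr)%N in
    let be := (1 + count (fun e => ~~ inT e.1.1.1) tr)%N in
    let chi := w n' < al%:R / (al + be)%:R in
    let aac := if chi then apm else own n' in
    rcons tr (apm, chi, aac, rew n' aac)
  end.

Definition of_nat_arm (R : realType) (K : nat) (f : 'I_K -> R) (a : nat) : R :=
  match insub a with Some k => f k | None => 0 end.

Definition mean_rew (R : realType) (d : measure_display) (T : measurableType d)
    (P : probability T R) (K : nat) (Rw : nat -> 'I_K -> T -> R) (k : 'I_K) : R :=
  fine (\int[P]_x (Rw 0%N k x)%:E).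

Definition opt_rew (R : realType) (K : nat) (r : 'I_K -> R) : R :=
  \big[Num.max/0]_(k < K) r k.

Definition regret (R : realType) (K : nat) (r : 'I_K -> R) (tr : seq (nat * bool * nat * R)) : R :=
  \sum_(e <- tr) (opt_rew r - of_nat_arm r e.1.2).

Definition tucb_regret (R : realType) (d : measure_display) (T : measurableType d)
    (P : probability T R) (K H : nat) (Tr : {set 'I_K})
    (Rw : nat -> 'I_K -> T -> R) (W U : nat -> T -> R) (O : nat -> T -> 'I_K) (x : T) : R :=
  regret (mean_rew P Rw)
    (trajectory K H (fun a => [exists k : 'I_K, (k \in Tr) && (nat_of_ord k == a)])
       (fun h => of_nat_arm (fun k => Rw h k x)) (fun h => W h x) (fun h => U h x)
       (fun h => nat_of_ord (O h x)) H).

(* Main.v *)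
Require Import Defs.
From HB Require Import structures.
From mathcomp Require Import all_boot all_order all_algebra.
From mathcomp Require Import all_classical all_reals all_analysis.
From mathcomp Require Import measurable_realfun.
From mathcomp Require Import ring lra zify.
Set Implicit Arguments. Unset Strict Implicit. Unset Printing Implicit Defensive.
Import Order.TTheory GRing.Theory Num.Theory.
Import numFieldNormedType.Exports.
Local Open Scope ring_scope.
Local Open Scope classical_set_scope.

(**
While the trust set estimate is being built, recommendations are deterministic, so the
trust levels are deterministic too and the indicators [chi_h] are independent
Bernoulli variables.  In the block of [2m] recommendations of arm [k], the trust level
moves monotonically, up or down according to whether the arm is trusted; the mean
shift between the two halves of the block is compared with the fluctuations by a
Bernstein bound (the shift may be as small as [1/(2k^2)], but then the variance is
small as well) or, when all earlier arms have the opposite status, by Hoeffding's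
inequality.  Since [m >= 30 K^3 ln H], each arm is misclassified with probability at
most [1/H].

When the estimate is exact, every recommendation of the second stage is trusted, so
the trust levels remain deterministic and [1 - t_h <= (1 + H0)/(h + 1)]: the expected
number of rounds in which the implementer follows its own policy is [O(H0 ln H)].  In
the other rounds the arm pulled maximises the UCB index over a set that contains an
optimal arm.  Empirical means are controlled by the supermartingale
[exp (lam S_n(a) - lam^2 N_n(a) / 8)] with a union bound over the number of pulls, and
the sum of the confidence radii is bounded by the potential [3 sum_a sqrt N(a)].
*)

(** * Exponential moments *)

(** The obstacle is adaptivity, and it is removed by comparison with [ideal_trust], a deterministic
    sequence. The tests of the first stage are studied on the indicators [W h x < ideal_trust h],
    with the true number of earlier trusted arms in the threshold: each is then a statement about
    [W] alone, and no bound is conditioned on earlier answers being right. Along a fixed sample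
    point where all these tests succeed, an induction shows that they are the tests the algorithm
    performs. In the same way, the rounds lost to the own policy are counted by events
    [ideal_trust i <= W i], whose probability is known without restriction to a good event.
    Adaptivity remains only in the reward of an arm chosen from the past. Independence is given as a
    product formula on rectangles; a pi-system argument extends it to the sigma-algebra of a history
    that determines the arm pulled at a round but not the rewards of that round. The good event
    fails with probability at most [2 K / H]; as the regret never exceeds [H], the failure costs
    [2 K]. *)

Section Analysis.
Variable R : realType.
Implicit Types p q s x : R.

Lemma ge0_of_derive_ge0 (f df : R -> R) : f 0 = 0 ->
  (forall x, is_derive x 1 f (df x)) -> (forall x, 0 <= x -> 0 <= df x) ->
  forall x, 0 <= x -> 0 <= f x.
Proof.
move=> f0 fE df0 x; rewrite le_eqVlt => /predU1P[<-|x0]; first by rewrite f0.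
have [|c /andP[c0 _]] := @MVT R f df 0 x x0 (fun y _ => fE y).
- by apply: derivable_within_continuous => y _; have [] := fE y.
- by rewrite f0 !subr0 => ->; rewrite mulr_ge0 ?df0// ltW.
Qed.

Lemma two_point_gt0 p s : 0 <= p <= 1 -> 0 < 1 - p + p * expR s.
Proof.
move=> /andP[p0 p1]; have e0 := expR_gt0 s.
have [->|pn0] := eqVneq p 0; first by rewrite mul0r subr0 addr0.
by rewrite ltr_wpDl ?subr_ge0// mulr_gt0// lt_def pn0.
Qed.

(** The logarithm [g] of the quotient of the right side by the left one vanishes at 0 together with
    its derivative [g1]. Its second derivative is [1/4 - t (1 - t) = (1 - 2 t)^2 / 4], where [t] is
    the tilted probability [p e^x / (1 - p + p e^x)]; this is the square [g2]. *)
Let hoeffding_two_point_ge0 p s : 0 <= p <= 1 -> 0 <= s ->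
  1 - p + p * expR s <= expR (p * s + s ^+ 2 / 8).
Proof.
move=> p01 s0.
have D0 x := two_point_gt0 x p01.
pose g x := p * x + x ^+ 2 / 8 - ln (1 - p + p * expR x).
pose g1 x := p + x / 4 - p * expR x / (1 - p + p * expR x).
pose g2 x := (1 - p - p * expR x) ^+ 2 / (4 * (1 - p + p * expR x) ^+ 2).
have dD x : is_derive x 1 (fun y => 1 - p + p * expR y) (p * expR x).
  by apply: is_derive_eq; rewrite /GRing.scale/=; ring.
have g1E x : is_derive x 1 g1 (g2 x).
  have dV : is_derive x 1 (fun y => (1 - p + p * expR y)^-1)
      (- ((1 - p + p * expR x) ^- 2) *: (p * expR x)).
    by apply: is_deriveV; rewrite gt_eqF.
  apply: is_derive_eq; rewrite /GRing.scale/= /g2; field.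
  by rewrite gt_eqF.
have gE x : is_derive x 1 g (g1 x).
  have dl : is_derive x 1 (fun y => ln (1 - p + p * expR y))
      ((1 - p + p * expR x)^-1 * (p * expR x)).
    apply: (is_derive1_comp (f := @ln R)).
    exact: is_derive1_ln.
  apply: is_derive_eq; rewrite /GRing.scale/= /g1; field.
  by rewrite gt_eqF.
have g1_ge0 x : 0 <= x -> 0 <= g1 x.
  apply: (@ge0_of_derive_ge0 g1 g2) => //.
    by rewrite /g1 expR0 mulr1 mul0r addr0 subrK divr1 subrr.
  by move=> y _; rewrite divr_ge0 ?sqr_ge0// mulr_ge0// sqr_ge0.
have g_ge0 : 0 <= g s.
  apply: (@ge0_of_derive_ge0 g g1) => //.
  by rewrite /g expR0 mulr1 mulr0 expr0n mul0r addr0 subrK ln1 subrr.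
by rewrite -ler_ln ?posrE ?expR_gt0// expRK -subr_ge0.
Qed.

Lemma hoeffding_two_point p s : 0 <= p <= 1 ->
  1 - p + p * expR s <= expR (p * s + s ^+ 2 / 8).
Proof.
move=> p01; have [s0|s0] := leP 0 s; first exact: hoeffding_two_point_ge0.
(* Exchanging the two outcomes turns [(p, s)] into [(1 - p, - s)]. *)
have q01 : 0 <= 1 - p <= 1 by lra.
have := @hoeffding_two_point_ge0 (1 - p) (- s) q01.
rewrite oppr_ge0 => /(_ (ltW s0)) h.
have -> : 1 - p + p * expR s =
    expR s * (1 - (1 - p) + (1 - p) * expR (- s)).
  by rewrite expRN; field; rewrite gt_eqF// expR_gt0.
have -> : p * s + s ^+ 2 / 8 = s + ((1 - p) * - s + (- s) ^+ 2 / 8) by field.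
by rewrite expRD ler_pM2l// expR_gt0.
Qed.

Lemma expR_chord s x : 0 <= x <= 1 -> expR (s * x) <= 1 - x + x * expR s.
Proof.
move=> /andP[x0 x1].
pose t : {i01 R} := Itv01 x0 x1.
have /= := convex_expR t s 0.
by rewrite !convRE /= /unstable.onem expR0 mulr0 addr0 mulr1 mulrC addrC.
Qed.

(** The constant 15/16 is the largest for which the sign test, after optimising [lam], still has the
    exponent [m / (30 k^3)] that matches the block length. Squaring [e^(x/2) <= 1 / (1 - x/2)] is
    enough: the coefficient leaves a surplus [3 x^2 / 16] against a cubic term [11 x^3 / 16]. *)
Lemma expR_le_quadratic x : `|x| <= 6^-1 ->
  expR x <= 1 + x + 15 / 16 * x ^+ 2.
Proof.
rewrite ler_norml => /andP[xl xu].
have h : 0 < 1 - x / 2 by lra.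
have e1 : expR (x / 2) <= (1 - x / 2)^-1.
  rewrite -[expR _]invrK -expRN lef_pV2 ?posrE ?expR_gt0//.
  by apply: le_trans (expR_ge1Dx _); lra.
have -> : expR x = expR (x / 2) ^+ 2.
  by rewrite -expRM_natl; congr expR; field.
apply: (@le_trans _ _ ((1 - x / 2)^-1 ^+ 2)).
  by rewrite ler_pXn2r// ?nnegrE ?expR_ge0// invr_ge0 ltW.
rewrite exprVn -[leRHS]mulr1 -ler_pdivrMl; last by nra.
rewrite -invfM invf_le1; last by nra.
nra.
Qed.

(** The moment generating function at [s] of a centred Bernoulli variable of parameter [q]. *)
Definition bern_mgf q s := (1 - q) * expR (s * (0 - q)) + q * expR (s * (1 - q)).

Lemma bern_mgf_hoeffding q s : 0 <= q <= 1 -> bern_mgf q s <= expR (s ^+ 2 / 8).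
Proof.
move=> q01; rewrite /bern_mgf.
have -> : s * (1 - q) = s * (0 - q) + s by ring.
rewrite expRD.
have -> : s ^+ 2 / 8 = s * (0 - q) + (q * s + s ^+ 2 / 8) by ring.
rewrite expRD.
have := hoeffding_two_point s q01.
move: (expR_gt0 (s * (0 - q))) => e0.
rewrite -(ler_pM2l e0); apply: le_trans.
by rewrite le_eqVlt; apply/orP; left; apply/eqP; ring.
Qed.

(** Centring cancels the linear terms, and the quadratic ones add up to the variance:
    [q (1 - q)^2 + (1 - q) q^2 = q (1 - q)]. *)
Lemma bern_mgf_bernstein q s : 0 <= q <= 1 -> `|s| <= 6^-1 ->
  bern_mgf q s <= expR (15 / 16 * s ^+ 2 * (q * (1 - q))).
Proof.
move=> q01 s6; rewrite /bern_mgf.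
have /andP[q0 q1] := q01.
have e1 : `|s * (0 - q)| <= 6^-1.
  rewrite normrM; apply: le_trans s6; rewrite ler_piMr//.
  by rewrite sub0r normrN ger0_norm.
have e2 : `|s * (1 - q)| <= 6^-1.
  by rewrite normrM; apply: le_trans s6; rewrite ler_piMr// ger0_norm; lra.
have {}e1 := expR_le_quadratic e1.
have {}e2 := expR_le_quadratic e2.
apply: le_trans (expR_ge1Dx _).
have {}e1 := ler_wpM2l (_ : 0 <= 1 - q) e1.
have {}e2 := ler_wpM2l q0 e2.
apply: le_trans (lerD (e1 _) e2) _; first by lra.
by rewrite le_eqVlt; apply/orP; left; apply/eqP; field.
Qed.

(** Bounds [ln H] below for every [H >= 2], so that additive constants can be absorbed into
    multiples of [ln H]. *)
Lemma ln2_ge_half : 2^-1 <= ln 2 :> R.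
Proof.
rewrite -[leLHS]expRK ler_ln ?posrE ?expR_gt0//.
have : 2^-1 <= expR (- 2^-1) :> R by apply: le_trans (expR_ge1Dx _); lra.
by rewrite expRN lef_pV2 ?posrE ?expR_gt0.
Qed.

End Analysis.

(** * Independence and Chernoff bounds *)

Section Independence.
Context (R : realType) (d : measure_display) (T : measurableType d)
  (P : probability T R).
Local Open Scope ereal_scope.

(** The law of the pair agrees with the product of the marginal laws on rectangles, hence
    everywhere, and Tonelli's theorem applies. *)
Lemma indep_integralM d1 d2 (T1 : measurableType d1) (T2 : measurableType d2)
    (X : T -> T1) (Y : T -> T2) (f : T1 -> \bar R) (g : T2 -> \bar R) :
  measurable_fun setT X -> measurable_fun setT Y ->
  (forall A B, measurable A -> measurable B ->
    P (X @^-1` A `&` Y @^-1` B) = P (X @^-1` A) * P (Y @^-1` B)) ->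
  measurable_fun setT f -> measurable_fun setT g ->
  (forall x, 0 <= f x) -> (forall y, 0 <= g y) ->
  \int[P]_x (f (X x) * g (Y x)) = (\int[P]_x f (X x)) * \int[P]_x g (Y x).
Proof.
move=> mX mY ind mf mg f0 g0.
pose X' : {mfun T >-> T1} := HB.pack X (isMeasurableFun.Build _ _ _ _ _ mX).
pose Y' : {mfun T >-> T2} := HB.pack Y (isMeasurableFun.Build _ _ _ _ _ mY).
have mZ : measurable_fun setT (fun x => (X x, Y x)).
  exact: measurable_fun_pair.
pose Z' : {mfun T >-> (T1 * T2)%type} :=
  HB.pack (fun x => (X x, Y x)) (isMeasurableFun.Build _ _ _ _ _ mZ).
have mfg : measurable_fun setT (fun z : T1 * T2 => f z.1 * g z.2).
  by apply: emeasurable_funM; exact: measurableT_comp.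
have -> : \int[P]_x (f (X x) * g (Y x)) =
    \int[distribution P Z']_z (f z.1 * g z.2).
  by rewrite ge0_integral_distribution// => z; exact: mule_ge0.
have ZE A : measurable A -> distribution P Z' A =
    (distribution P X' \x distribution P Y') A.
  move=> mA; apply/esym; exact: product_measure_unique.
rewrite (eq_measure_integral (distribution P X' \x distribution P Y')); last first.
  by move=> A mA _; exact: ZE.
rewrite fubini_tonelli1//=; last by move=> z; exact: mule_ge0.
rewrite /fubini_F /=.
under eq_integral do rewrite ge0_integralZl//.
rewrite ge0_integralZr//; last exact: integral_ge0.
by rewrite ge0_integral_distribution// ge0_integral_distribution.
Qed.

(** For fixed [B], two finite measures of [A], namely [P (A /\ Y in B)] and [P A * P (Y in B)],
    agree on the pi-system [G], hence on the sigma-algebra it generates. Giving the domain of [f]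
    this sigma-algebra expresses that [f] uses only the information in [G]. *)
Lemma indep_pi_system_integralM d2 (T2 : measurableType d2)
    (G : set (set T)) (Y : T -> T2)
    (f : g_sigma_algebraType G -> \bar R) (g : T2 -> \bar R) :
  G `<=` measurable -> G setT -> setI_closed G ->
  measurable_fun setT Y ->
  (forall Q B, G Q -> measurable B ->
    P (Q `&` Y @^-1` B) = P Q * P (Y @^-1` B)) ->
  measurable_fun setT f -> measurable_fun setT g ->
  (forall x, 0 <= f x) -> (forall y, 0 <= g y) ->
  \int[P]_x (f x * g (Y x)) = (\int[P]_x f x) * \int[P]_x g (Y x).
Proof.
move=> Gm GT GI mY ind mf mg f0 g0.
have mid : measurable_fun setT (id : T -> g_sigma_algebraType G).
  move=> _ A mA; rewrite setTI preimage_id.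
  exact: (smallest_sub (@sigma_algebra_measurable _ T) Gm).
apply: (@indep_integralM _ _ (g_sigma_algebraType G) T2 id Y f g) => // A B mA mB.
rewrite preimage_id.
have mYB : measurable (Y @^-1` B) by rewrite -[_ @^-1` _]setTI; exact: mY.
have PB0 : (0 <= fine (P (Y @^-1` B)))%R by rewrite fine_ge0.
pose m1 : {measure set T -> \bar R} := mrestr P mYB.
pose m2 : {measure set T -> \bar R} := mscale (NngNum PB0) P.
suff : m1 A = m2 A.
  by rewrite /m1 /m2 /= /mrestr /mscale /= fineK ?fin_num_measure// muleC.
apply: (@g_sigma_algebra_measure_unique _ R T G Gm (fun _ => setT)) => //.
- by rewrite bigcup_const//; exists 0%N.
- move=> Q GQ; rewrite /m1 /m2 /= /mrestr /mscale /= fineK ?fin_num_measure//.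
  by rewrite ind// muleC.
- by move=> _; rewrite /m1 /= /mrestr setTI ltey_eq fin_num_measure.
Qed.

End Independence.

(** * Independence of a round from the past *)

Section Model.
Context (R : realType) (K : nat) (d : measure_display) (T : measurableType d)
  (P : probability T R).
Variables (Rw : nat -> 'I_K -> T -> R) (W U : nat -> T -> R) (O : nat -> T -> 'I_K).
Hypothesis mRw : forall h k, measurable_fun setT (Rw h k).
Hypothesis mW : forall h, measurable_fun setT (W h).
Hypothesis mU : forall h, measurable_fun setT (U h).
Hypothesis mO : forall h (S : {set 'I_K}), measurable [set x | O h x \in S].

Definition cell (B : nat -> 'I_K -> set R) (BW BU : nat -> set R)
    (S : nat -> {set 'I_K}) (h : nat) : set T :=
  (\bigcap_(k in [set: 'I_K]) (Rw h k @^-1` B h k))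
    `&` (W h @^-1` BW h) `&` [set x | O h x \in S h] `&` (U h @^-1` BU h).

Definition rect n B BW BU S := \bigcap_(h in [set h | (h < n)%N]) cell B BW BU S h.

Definition independent_rounds := forall (n : nat) (B : nat -> 'I_K -> set R)
    (BW BU : nat -> set R) (S : nat -> {set 'I_K}),
     (forall h k, measurable (B h k)) -> (forall h, measurable (BW h)) ->
     (forall h, measurable (BU h)) ->
     fine (P (rect n B BW BU S))
     = \prod_(h < n)
         (fine (P (\bigcap_(k in [set: 'I_K]) (Rw h k @^-1` B h k)))
          * fine (P (W h @^-1` BW h)) * fine (P [set x | O h x \in S h])
          * fine (P (U h @^-1` BU h))).
Hypothesis indep : independent_rounds.

(* Generators of the information carried by the first [n] rounds, in which the
   rewards of a round [h] are visible only when [vis h] holds. *)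
Definition history n (vis : pred nat) : set (set T) :=
  [set Q | exists B BW BU S,
     [/\ (forall h k, measurable (B h k)), (forall h, measurable (BW h)),
         (forall h, measurable (BU h)),
         (forall h k, ~~ vis h -> B h k = setT) & Q = rect n B BW BU S]].

Lemma cellP B BW BU S h x : cell B BW BU S h x <->
  [/\ forall k, B h k (Rw h k x), BW h (W h x), O h x \in S h & BU h (U h x)].
Proof.
split=> [[[[h1 h2] h3] h4]|[h1 h2 h3 h4]]; first by split => // k; exact: h1.
by do 3 split => //; move=> k _; exact: h1.
Qed.

Lemma measurable_cell B BW BU S h :
  (forall h k, measurable (B h k)) -> (forall h, measurable (BW h)) ->
  (forall h, measurable (BU h)) -> measurable (cell B BW BU S h).
Proof.
move=> mB mBW mBU; apply: measurableI; last first.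
  by rewrite -[_ @^-1` _]setTI; exact: mU.
apply: measurableI; last exact: mO.
apply: measurableI; last by rewrite -[_ @^-1` _]setTI; exact: mW.
apply: fin_bigcap_measurable => [|k _]; first exact: finite_finset.
by rewrite -[_ @^-1` _]setTI; exact: mRw.
Qed.

Lemma history_measurable n vis : history n vis `<=` measurable.
Proof.
move=> _ [B [BW [BU [S [mB mBW mBU _ ->]]]]].
apply: bigcap_measurableType => h _; exact: measurable_cell.
Qed.

Lemma history_setT n vis : history n vis setT.
Proof.
exists (fun _ _ => setT), (fun=> setT), (fun=> setT), (fun=> finset.setTfor _).
split=> //; apply/seteqP; split=> // x _ h _; apply/cellP; split => //.
by rewrite finset.in_setT.
Qed.

Lemma history_setI_closed n vis : setI_closed (history n vis).
Proof.
move=> _ _ [B [BW [BU [S [mB mBW mBU oB ->]]]]]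
  [B' [BW' [BU' [S' [mB' mBW' mBU' oB' ->]]]]].
exists (fun h k => B h k `&` B' h k), (fun h => BW h `&` BW' h),
  (fun h => BU h `&` BU' h), (fun h => finset.setI (S h) (S' h)).
split.
- by move=> h k; exact: measurableI.
- by move=> h; exact: measurableI.
- by move=> h; exact: measurableI.
- by move=> h k oh; rewrite oB// oB'// setTI.
- apply/seteqP; split=> x.
  + move=> [h1 h2] h hn.
    have /cellP[a1 a2 a3 a4] := h1 h hn; have /cellP[b1 b2 b3 b4] := h2 h hn.
    by apply/cellP; split => //; rewrite finset.inE a3.
  + move=> h1; split=> h hn; have /cellP[a1 a2 a3 a4] := h1 h hn;
      move: a3; rewrite finset.inE => /andP[a3 a3']; apply/cellP; split => //.
    * by move=> k; case: (a1 k).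
    * by case: a2.
    * by case: a4.
    * by move=> k; case: (a1 k).
    * by case: a2.
    * by case: a4.
Qed.

Let mgen n vis B BW BU S : (forall h k, measurable (B h k)) ->
  (forall h, measurable (BW h)) -> (forall h, measurable (BU h)) ->
  (forall h k, ~~ vis h -> B h k = setT) ->
  measurable (rect n B BW BU S : set (g_sigma_algebraType (history n vis))).
Proof. by move=> *; apply: sub_sigma_algebra; exists B, BW, BU, S. Qed.

Lemma history_measurable_Rw n (vis : pred nat) h k : (h < n)%N -> vis h ->
  measurable_fun setT (Rw h k : g_sigma_algebraType (history n vis) -> R).
Proof.
move=> hn vh _ A mA; rewrite setTI.
rewrite [X in measurable X](_ : _ = rect n
  (fun h' k' => if (h' == h) && (k' == k) then A else setT)
  (fun=> setT) (fun=> setT) (fun=> finset.setTfor _)); last first.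
  apply/seteqP; split=> x.
    move=> Ax h' _; apply/cellP; split; rewrite ?finset.in_setT// => k'.
    by case: ifPn => // /andP[/eqP -> /eqP ->].
  by move=> /(_ h hn)/cellP[/(_ k)]; rewrite !eqxx.
apply: mgen => //.
- by move=> h' k'; case: ifPn.
- by move=> h' k' nv; case: ifPn => // /andP[/eqP h'h _]; rewrite h'h vh in nv.
Qed.

Lemma history_measurable_W n vis h : (h < n)%N ->
  measurable_fun setT (W h : g_sigma_algebraType (history n vis) -> R).
Proof.
move=> hn _ A mA; rewrite setTI.
rewrite [X in measurable X](_ : _ = rect n (fun _ _ => setT)
  (fun h' => if h' == h then A else setT) (fun=> setT)
  (fun=> finset.setTfor _)); last first.
  apply/seteqP; split=> x.
    move=> Ax h' _; apply/cellP; split; rewrite ?finset.in_setT//.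
    by case: ifPn => // /eqP ->.
  by move=> /(_ h hn)/cellP[_]; rewrite eqxx.
by apply: mgen => // h'; case: ifPn.
Qed.

Lemma history_measurable_U n vis h : (h < n)%N ->
  measurable_fun setT (U h : g_sigma_algebraType (history n vis) -> R).
Proof.
move=> hn _ A mA; rewrite setTI.
rewrite [X in measurable X](_ : _ = rect n (fun _ _ => setT) (fun=> setT)
  (fun h' => if h' == h then A else setT)
  (fun=> finset.setTfor _)); last first.
  apply/seteqP; split=> x.
    move=> Ax h' _; apply/cellP; split; rewrite ?finset.in_setT//.
    by case: ifPn => // /eqP ->.
  by move=> /(_ h hn)/cellP[_ _ _]; rewrite eqxx.
by apply: mgen => // h'; case: ifPn.
Qed.

Lemma history_measurable_O n vis h (S : {set 'I_K}) : (h < n)%N ->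
  measurable ([set x | O h x \in S] : set (g_sigma_algebraType (history n vis))).
Proof.
move=> hn; rewrite [X in measurable X](_ : _ = rect n (fun _ _ => setT)
  (fun=> setT) (fun=> setT)
  (fun h' => if h' == h then S else finset.setTfor _)); last first.
  apply/seteqP; split=> x.
    move=> Sx h' _; apply/cellP; split => //.
    by case: ifPn => [/eqP ->//|_]; rewrite ?finset.in_setT.
  by move=> /(_ h hn)/cellP[_ _]; rewrite eqxx.
exact: mgen.
Qed.

Let fineP1 (A : set T) : A = setT -> fine (P A) = 1.
Proof. by move=> ->; rewrite probability_setT. Qed.

Let PM (A B C : set T) : measurable A -> measurable B -> measurable C ->
  fine (P A) = fine (P B) * fine (P C) -> P A = (P B * P C)%E.
Proof.
move=> mA mB mC h.
by rewrite -[LHS]fineK ?fin_num_measure// h EFinM !fineK ?fin_num_measure.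
Qed.

Let bigcapT (B : 'I_K -> set R) h : (forall k, B k = setT) ->
  \bigcap_(k in [set: 'I_K]) (Rw h k @^-1` B k) = setT.
Proof.
by move=> BT; apply/seteqP; split => // x _ k _; rewrite /= BT.
Qed.

(** The intersection is a rectangle of [n.+1] rounds whose last round constrains [W n] only, so the
    other factors of that round are 1. *)
Lemma indep_W_history n Q B : history n xpredT Q -> measurable B ->
  P (Q `&` W n @^-1` B) = (P Q * P (W n @^-1` B))%E.
Proof.
move=> hQ mB; have mQ := history_measurable hQ.
have mWB : measurable (W n @^-1` B) by rewrite -[_ @^-1` _]setTI; exact: mW.
move: hQ => [A [BW [BU [S [mA mBW mBU _ QE]]]]].
apply: PM => //; first exact: measurableI.
pose A' h k := if h == n then setT else A h k.
pose BW' h := if h == n then B else BW h.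
pose BU' h := if h == n then setT else BU h.
pose S' h := if h == n then finset.setTfor _ else S h.
have -> : Q `&` W n @^-1` B = rect n.+1 A' BW' BU' S'.
  rewrite QE; apply/seteqP; split=> x.
    move=> [Qx Wx] h /=; rewrite ltnS leq_eqVlt => /predU1P[->|hn].
      by apply/cellP; rewrite /A' /BW' /BU' /S' eqxx finset.in_setT.
    have /cellP := Qx h hn.
    by move=> ?; apply/cellP; rewrite /A' /BW' /BU' /S' (ltn_eqF hn).
  move=> Qx; split.
    move=> h /= hn; have /cellP := Qx h (ltnW hn).
    by rewrite /A' /BW' /BU' /S' (ltn_eqF hn) => ?; apply/cellP.
  by have /cellP[_] := Qx n (ltnSn n); rewrite /BW' eqxx.
rewrite indep; last 3 first.
- by move=> h k; rewrite /A'; case: ifP.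
- by move=> h; rewrite /BW'; case: ifP.
- by move=> h; rewrite /BU'; case: ifP.
rewrite big_ord_recr/= QE indep//; congr (_ * _).
  by apply: eq_bigr => h _; rewrite /A' /BW' /BU' /S' (ltn_eqF (ltn_ord h)).
rewrite /A' /BW' /BU' /S' eqxx (bigcapT n)// (fineP1 erefl).
have -> : [set x | O n x \in finset.setTfor _] = setT.
  by apply/seteqP; split => // x _ /=; rewrite finset.in_setT.
by rewrite (fineP1 erefl) mulr1 mul1r mulr1.
Qed.

(** This history sees [W n], [U n] and [O n] but not the rewards of round [n]: it determines the arm
    pulled at round [n] and is independent of the reward of any fixed arm at that round. It takes
    the place of conditioning on the past. *)
Lemma indep_Rw_history n a Q B : history n.+1 (fun h => h != n) Q ->
  measurable B -> P (Q `&` Rw n a @^-1` B) = (P Q * P (Rw n a @^-1` B))%E.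
Proof.
move=> hQ mB; have mQ := history_measurable hQ.
have mRB : measurable (Rw n a @^-1` B) by rewrite -[_ @^-1` _]setTI; exact: mRw.
move: hQ => [A [BW [BU [S [mA mBW mBU oA QE]]]]].
have AT k : A n k = setT by apply: oA; rewrite eqxx.
apply: PM => //; first exact: measurableI.
pose A' h k := if (h == n) && (k == a) then B else A h k.
have -> : Q `&` Rw n a @^-1` B = rect n.+1 A' BW BU S.
  rewrite QE; apply/seteqP; split=> x.
    move=> [Qx Rx] h /= hn.
    have /cellP[Ax ? ? ?] := Qx h hn.
    apply/cellP; split => // k; rewrite /A'; case: ifPn => [/andP[/eqP -> /eqP ->]//|_].
    exact: Ax.
  move=> Qx; split.
    move=> h /= hn; have /cellP[Ax ? ? ?] := Qx h hn.
    apply/cellP; split => // k; have := Ax k; rewrite /A'.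
    by case: ifPn => // /andP[/eqP -> _]; rewrite AT.
  by have /cellP[/(_ a)] := Qx n (ltnSn n); rewrite /A' !eqxx.
rewrite indep//; last by move=> h k; rewrite /A'; case: ifP.
rewrite big_ord_recr/= QE indep// big_ord_recr/=.
have -> : \bigcap_(k in [set: 'I_K]) (Rw n k @^-1` A n k) = setT.
  by apply/seteqP; split => // x _ k _ /=; rewrite AT.
have -> : \bigcap_(k in [set: 'I_K]) (Rw n k @^-1` A' n k) = Rw n a @^-1` B.
  apply/seteqP; split=> x.
    by move=> /(_ a I); rewrite /A' /= !eqxx.
  by move=> Rx k _; rewrite /A' /= eqxx/=; case: ifPn => [/eqP ->//|_]; rewrite AT.
rewrite [fine (P setT)]fineP1// mul1r.
rewrite [X in X * _ = _](_ : _ = \prod_(h < n)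
   (fine (P (\bigcap_(k in [set: 'I_K]) (Rw h k @^-1` A h k)))
          * fine (P (W h @^-1` BW h)) * fine (P [set x | O h x \in S h])
          * fine (P (U h @^-1` BU h)))); last first.
  by apply: eq_bigr => h _; rewrite /A' (ltn_eqF (ltn_ord h)).
by ring.
Qed.

Lemma integral_prod_W_le n (f : nat -> R -> R) (c : nat -> R) :
  (forall h, measurable_fun setT (f h)) -> (forall h y, 0 <= f h y) ->
  (forall h, (h < n)%N -> (\int[P]_x (f h (W h x))%:E <= (c h)%:E)%E) ->
  (\int[P]_x (\prod_(h < n) f h (W h x))%:E <= (\prod_(h < n) c h)%:E)%E.
Proof.
move=> mf f0; elim: n => [|n IH] hc.
  under eq_integral do rewrite big_ord0.
  rewrite big_ord0 integral_cst//.
  by rewrite mul1e; exact: probability_le1.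
under eq_integral do rewrite big_ord_recr/= EFinM.
rewrite (@indep_pi_system_integralM _ _ _ P _ _ (history n xpredT) (W n)
  (fun x => (\prod_(h < n) f h (W h x))%:E) (fun y => (f n y)%:E)).
- rewrite big_ord_recr/= EFinM; apply: lee_pmul.
  + by apply: integral_ge0 => x _; rewrite lee_fin prodr_ge0.
  + by apply: integral_ge0 => x _; rewrite lee_fin.
  + by apply: IH => h hn; apply: hc; exact: ltnW.
  + exact: hc.
- exact: history_measurable.
- exact: history_setT.
- exact: history_setI_closed.
- exact: mW.
- by move=> Q B; exact: indep_W_history.
- apply/measurable_EFinP; apply: measurable_prod => h _.
  apply: measurableT_comp; [exact: mf|exact: history_measurable_W].
- exact/measurable_EFinP.
- by move=> x; rewrite lee_fin prodr_ge0.
- by move=> x; rewrite lee_fin.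
Qed.

Lemma integral_history_Rw n a
    (f : g_sigma_algebraType (history n.+1 (fun h => h != n)) -> \bar R)
    (g : R -> \bar R) :
  measurable_fun setT f -> measurable_fun setT g ->
  (forall x, 0 <= f x)%E -> (forall y, 0 <= g y)%E ->
  (\int[P]_x (f x * g (Rw n a x)) = (\int[P]_x f x) * \int[P]_x g (Rw n a x))%E.
Proof.
move=> *; apply: indep_pi_system_integralM => //.
- exact: history_measurable.
- exact: history_setT.
- exact: history_setI_closed.
- by move=> Q B; exact: indep_Rw_history.
Qed.

Lemma markov_expR (X : T -> R) (c : R) : measurable_fun setT X ->
  (P [set x | (c <= X x)%R] <= \int[P]_x (expR (X x - c))%:E)%E.
Proof.
move=> mX.
have mA : measurable [set x | (c <= X x)%R].
  by rewrite -[X in measurable X]setTI; exact: measurable_fun_le.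
rewrite -[X in P X]setIT -integral_indic//.
apply: ge0_le_integral => //.
- exact/measurable_EFinP.
- apply/measurable_EFinP; apply: measurableT_comp => //.
  exact: measurable_funB.
- move=> x _; rewrite lee_fin indicE; have [|_] := boolP (x \in _).
    by rewrite inE /= => cX; rewrite -expR0 ler_expR subr_ge0.
  exact: expR_ge0.
Qed.

Hypothesis W_law : forall h (y : R), 0 <= y <= 1 ->
  P (W h @^-1` [set z | z < y]) = y%:E.

Let mWlt h y : measurable (W h @^-1` [set z | z < y]).
Proof.
rewrite -[X in measurable X]setTI.
have -> : [set z | z < y] = `]-oo, y[ :> set R.
  by apply/seteqP; split => z /=; rewrite in_itv.
exact: mW.
Qed.

Lemma W_ge_law h (y : R) : 0 <= y <= 1 ->
  P [set x | y <= W h x] = (1 - y)%:E.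
Proof.
move=> y01; have -> : [set x | y <= W h x] = ~` (W h @^-1` [set z | z < y]).
  by apply/seteqP; split => x /=; rewrite leNgt => /negP.
by rewrite probability_setC// W_law.
Qed.

Lemma integral_bern_W h (q s : R) : 0 <= q <= 1 ->
  (\int[P]_x (expR (s * ((W h x < q)%R%:R - q)))%:E = (bern_mgf q s)%:E)%E.
Proof.
move=> q01; set A := W h @^-1` [set z | z < q].
have mA : measurable A by exact: mWlt.
rewrite (eq_integral (fun x => (expR (s * (0 - q)) * \1_(~` A) x)%:E
    + (expR (s * (1 - q)) * \1_A x)%:E)%E); last first.
  move=> x _; rewrite -EFinD; congr (_%:E); rewrite !indicE !in_setC.
  have -> : (x \in A) = (W h x < q) by apply/idP/idP; rewrite inE.
  by case: (W h x < q) => /=; rewrite !(mulr0, mulr1, addr0, add0r).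
have mC : measurable (~` A) by exact: measurableC.
have I (c : R) (B : set T) : 0 <= c -> measurable B ->
    (\int[P]_x (c * \1_B x)%:E = c%:E * P B)%E.
  move=> c0 mB; under eq_integral do rewrite EFinM.
  by rewrite ge0_integralZl// ?integral_indic// ?setIT//; exact/measurable_EFinP.
have J1 (c : R) (B : set T) : 0 <= c -> forall x, setT x -> (0 <= (c * \1_B x)%:E)%E.
  by move=> c0 x _; rewrite lee_fin mulr_ge0.
have J2 (c : R) (B : set T) : measurable B ->
    measurable_fun setT (fun x => (c * \1_B x)%:E).
  by move=> mB; apply/measurable_EFinP/measurable_funM.
rewrite (ge0_integralD P measurableT (J1 _ _ (expR_ge0 _)) (J2 _ _ mC)
  (J1 _ _ (expR_ge0 _)) (J2 _ _ mA)).
rewrite !I ?expR_ge0// probability_setC// W_law// -EFinB -!EFinM -EFinD.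
by rewrite /bern_mgf mulrC [expR _ * q]mulrC.
Qed.

Lemma measurable_bern_sum n (q s : nat -> R) : measurable_fun setT
  (fun x => \sum_(h < n) s h * ((W h x < q h)%R%:R - q h)).
Proof.
apply: measurable_sum => h; apply: measurable_funM => //.
apply: measurable_funB => //.
have -> : (fun x : T => (W h x < q h)%R%:R : R) = \1_(W h @^-1` [set z | z < q h]).
  apply/funext => x; rewrite indicE; congr ((nat_of_bool _)%:R).
  by apply/idP/idP; rewrite inE.
by apply: measurable_indic; exact: mWlt.
Qed.

(** The weights [s] may change in size and sign from round to round. The parameters [q] are
    deterministic, so the exponential factors are independent. *)
Lemma bern_chernoff n (q s v : nat -> R) (tau : R) :
  (forall h, 0 <= q h <= 1) ->
  (forall h, (h < n)%N -> bern_mgf (q h) (s h) <= expR (v h)) ->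
  (P [set x | (tau <= \sum_(h < n) s h * ((W h x < q h)%R%:R - q h))%R]
    <= (expR (\sum_(h < n) v h - tau))%:E)%E.
Proof.
move=> q01 hv.
have mf h : measurable_fun setT (fun y : R => expR (s h * ((y < q h)%R%:R - q h))).
  apply: measurableT_comp => //; apply: measurable_funM => //.
  apply: measurable_funB => //.
  have -> : (fun y : R => (y < q h)%R%:R : R) = \1_(`]-oo, q h[).
    by apply/funext => y; rewrite indicE mem_setE in_itv.
  exact: measurable_indic.
have mS := measurable_bern_sum n q s.
apply: (le_trans (markov_expR _ mS)).
rewrite addrC expRD EFinM.
under eq_integral do rewrite addrC expRD EFinM.
have -> : (\int[P]_x ((expR (- tau))%:E *
    (expR (\sum_(h < n) s h * ((W h x < q h)%R%:R - q h)))%:E) =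
    (expR (- tau))%:E *
    \int[P]_x (expR (\sum_(h < n) s h * ((W h x < q h)%R%:R - q h)))%:E)%E.
  apply: ge0_integralZl => //.
  all: try by move=> *; rewrite lee_fin expR_ge0.
  by apply/measurable_EFinP; exact: measurableT_comp.
apply: lee_pmul => //; rewrite ?lee_fin ?expR_ge0//.
  by apply: integral_ge0 => x _; rewrite lee_fin expR_ge0.
under eq_integral do rewrite expR_sum.
rewrite expR_sum.
apply: (@integral_prod_W_le n (fun h y => expR (s h * ((y < q h)%R%:R - q h)))
  (fun h => expR (v h))) => //.
by move=> h hn; rewrite integral_bern_W// lee_fin hv.
Qed.

Lemma block_tail (c m : nat) (q v : nat -> R) (A B tau : R) :
  (forall h, 0 <= q h <= 1) ->
  (forall i, (i < m)%N -> bern_mgf (q (c + i)%N) A <= expR (v (c + i)%N)) ->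
  (forall i, (i < m)%N -> bern_mgf (q (c + m + i)%N) B <= expR (v (c + m + i)%N)) ->
  exists E : set T, [/\ measurable E,
    (P E <= (expR (\sum_(i < m) v (c + i)%N + \sum_(i < m) v (c + m + i)%N
       - tau))%:E)%E &
    forall x, ~ E x ->
      A * \sum_(i < m) ((W (c + i)%N x < q (c + i)%N)%R%:R - q (c + i)%N) +
      B * \sum_(i < m) ((W (c + m + i)%N x < q (c + m + i)%N)%R%:R - q (c + m + i)%N)
      < tau].
Proof.
move=> q01 hA hB.
(* Zero weight before the block turns a statement about two half-blocks into one about the first
   [c + m + m] rounds. *)
pose s h := if (h < c)%N then 0 else if (h < c + m)%N then A else B.
pose v' h := if (h < c)%N then 0 else v h.
have split_sum (f g : nat -> R) (a b : R) :
    (forall h, (h < c)%N -> f h = 0) ->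
    (forall i, (i < m)%N -> f (c + i)%N = a * g (c + i)%N) ->
    (forall i, (i < m)%N -> f (c + m + i)%N = b * g (c + m + i)%N) ->
    \sum_(h < c + m + m) f h =
    a * \sum_(i < m) g (c + i)%N + b * \sum_(i < m) g (c + m + i)%N.
  move=> f0 fA fB; rewrite big_split_ord/= big_split_ord/= big1 ?add0r.
    rewrite !mulr_sumr.
    by congr (_ + _); apply: eq_bigr => i _; rewrite ?fA ?fB.
  by move=> i _; rewrite f0.
exists [set x | tau <= \sum_(h < c + m + m) s h * ((W h x < q h)%R%:R - q h)].
split.
- rewrite -[X in measurable X]setTI; apply: measurable_fun_le => //.
  exact: measurable_bern_sum.
- have := @bern_chernoff (c + m + m) q s v' tau q01.
  rewrite (split_sum v' v 1 1) ?mul1r; last 3 first.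
  + by move=> h hc; rewrite /v' hc.
  + by move=> i im; rewrite /v' ltnNge leq_addr mul1r.
  + by move=> i im; rewrite /v' ltnNge -addnA leq_addr mul1r.
  apply=> h; rewrite /s /v'; have [hc _|hc] := ltnP h c.
    by rewrite /bern_mgf !mul0r expR0; lra.
  have [hm _|hm hn] := ltnP h (c + m).
    by rewrite -(subnKC hc); apply: hA; rewrite ltn_subLR.
  by rewrite -(subnKC hm); apply: hB; rewrite ltn_subLR.
- move=> x /= /negP; rewrite -ltNge.
  rewrite (split_sum (fun h => s h * ((W h x < q h)%R%:R - q h))
    (fun h => (W h x < q h)%R%:R - q h) A B)//.
  + by move=> h hc; rewrite /s hc mul0r.
  + by move=> i im; rewrite /s ltnNge leq_addr/= ltn_add2l im.
  + by move=> i im; rewrite /s ltnNge -addnA leq_addr/= addnA ltnNge leq_addr.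
Qed.

End Model.

(** * Measurability of the play *)

Section DiscreteMeasurability.
Context (d : measure_display) (T : measurableType d).

(** Measurability for the discrete sigma-algebra on [D]: any function may be applied to the result,
    and for countable [D] the value can be frozen while the rest of an expression is examined, as in
    [dmeas_bind]. *)
Definition dmeas (D : Type) (f : T -> D) := forall A : set D, measurable (f @^-1` A).

Lemma measurable_disc_bind (D : countType) (f : T -> D) (Q : D -> T -> Prop) :
  dmeas f -> (forall s, measurable [set x | Q s x]) ->
  measurable [set x | Q (f x) x].
Proof.
move=> mf mQ.
rewrite [X in measurable X](_ : _ = \bigcup_n
  (if unpickle n is Some s then f @^-1` [set s] `&` [set x | Q s x] else set0)).
  by apply: bigcupT_measurable => n; case: unpickle => // s; exact: measurableI.
apply/seteqP; split=> x.
  by move=> Qx; exists (pickle (f x)) => //; rewrite pickleK.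
by move=> [n _]; case: unpickle => // s [/= ->].
Qed.

Lemma dmeas_comp (D E : Type) (f : T -> D) (g : D -> E) :
  dmeas f -> dmeas (g \o f).
Proof. by move=> mf A; exact: (mf (g @^-1` A)). Qed.

Lemma dmeas_cst (D : Type) (c : D) : dmeas (fun=> c).
Proof.
move=> A; have [Ac|nAc] := pselect (A c).
  by rewrite (_ : _ @^-1` _ = setT)//; apply/seteqP; split.
by rewrite (_ : _ @^-1` _ = set0)//; apply/seteqP; split.
Qed.

Lemma dmeas_bind (D : countType) (E : Type) (f : T -> D) (g : D -> T -> E) :
  dmeas f -> (forall s, dmeas (g s)) -> dmeas (fun x => g (f x) x).
Proof.
move=> mf mg A.
by apply: (@measurable_disc_bind D f (fun s x => A (g s x)) mf) => s; exact: mg.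
Qed.

Lemma dmeas_countP (D : countType) (f : T -> D) :
  (forall s, measurable [set x | f x = s]) -> dmeas f.
Proof.
move=> mf A.
rewrite [X in measurable X](_ : _ = \bigcup_n
  (if unpickle n is Some s then
     (if `[< A s >] then [set x | f x = s] else set0) else set0)).
  apply: bigcupT_measurable => n; case: unpickle => // s.
  by case: ifPn.
apply/seteqP; split=> x.
  by move=> Ax; exists (pickle (f x)) => //; rewrite pickleK; case: asboolP.
by move=> [n _]; case: unpickle => // s; case: asboolP => // As /= ->.
Qed.

Lemma dmeas_bool (b : T -> bool) : measurable [set x | b x] -> dmeas b.
Proof.
move=> mb; apply: dmeas_countP => -[]//.
rewrite [X in measurable X](_ : _ = ~` [set x | b x]); first exact: measurableC.
by apply/seteqP; split => x /=; case: (b x).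
Qed.

Lemma dmeas_filter (I : countType) (p : I -> T -> bool) (s : seq I) :
  (forall a, dmeas (p a)) -> dmeas (fun x => [seq a <- s | p a x]).
Proof.
move=> mp; elim: s => [|a s IH] /=; first exact: dmeas_cst.
apply: (dmeas_bind (g := fun (b : bool) x => if b then a :: [seq a <- s | p a x]
  else [seq a <- s | p a x]) (mp a)) => -[] //.
exact: (dmeas_comp (cons a) IH).
Qed.

Lemma measurable_bind (R : realType) (D : countType) (f : T -> D) (g : D -> T -> R) :
  dmeas f -> (forall s, measurable_fun setT (g s)) ->
  measurable_fun setT (fun x => g (f x) x).
Proof.
move=> mf mg _ A mA; rewrite setTI.
apply: (@measurable_disc_bind D f (fun s x => A (g s x)) mf) => s.
by rewrite -[X in measurable X]setTI; exact: mg.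
Qed.

Lemma dmeas_lt (R : realType) (f g : T -> R) :
  measurable_fun setT f -> measurable_fun setT g -> dmeas (fun x => f x < g x).
Proof.
move=> mf mg; apply: dmeas_bool.
rewrite [X in measurable X](_ : _ = ~` (setT `&` [set x | g x <= f x])).
  by apply: measurableC; exact: measurable_fun_le.
by rewrite setTI; apply/seteqP; split=> x /=; rewrite ltNge => /negP.
Qed.

Lemma dmeas_eq (R : realType) (f g : T -> R) :
  measurable_fun setT f -> measurable_fun setT g -> dmeas (fun x => f x == g x).
Proof.
move=> mf mg; apply: dmeas_bool.
rewrite [X in measurable X](_ : _ = (setT `&` [set x | f x <= g x]) `&`
  (setT `&` [set x | g x <= f x])).
  by apply: measurableI; exact: measurable_fun_le.
apply/seteqP; split=> x /=; first by move=> /eqP ->.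
by move=> [[_ h1] [_ h2]]; rewrite eq_le h1.
Qed.

Lemma dmeas_truncn (R : realType) (f : T -> R) :
  measurable_fun setT f -> dmeas (fun x => Num.truncn (f x)).
Proof.
move=> mf; apply: dmeas_countP => k.
have mge (j : nat) : measurable [set x | (j <= Num.truncn (f x))%N].
  case: j => [|j].
    by rewrite (_ : [set _ | _] = setT)//; apply/seteqP; split.
  rewrite [X in measurable X](_ : _ = setT `&` [set x | j.+1%:R <= f x]).
    exact: measurable_fun_le.
  by apply/seteqP; split=> x /=; rewrite truncn_gt_nat; tauto.
rewrite [X in measurable X](_ : _ = [set x | (k <= Num.truncn (f x))%N] `\`
  [set x | (k.+1 <= Num.truncn (f x))%N]).
  exact: measurableD.
apply/seteqP; split=> x /=.
  by move=> ->; rewrite ltnn; split.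
by move=> [h1 /negP h2]; apply/eqP; rewrite eqn_leq h1 leqNgt h2.
Qed.

End DiscreteMeasurability.

(** * The play as a function of the sample point *)

Section Trajectory.
Context (R : realType) (K H : nat) (inT : pred nat) (T : Type).
Variables (Rw : nat -> 'I_K -> T -> R) (W U : nat -> T -> R) (O : nat -> T -> 'I_K).

Definition rew h a x : R := of_nat_arm (fun k => Rw h k x) a.

Definition tr n x := trajectory K H inT (fun h a => rew h a x)
  (fun h => W h x) (fun h => U h x) (fun h => nat_of_ord (O h x)) n.

Definition observed (s : seq (nat * bool * nat * R)) : seq (nat * R * bool) :=
  [seq ((e.1.2, e.2), e.1.1.2) | e <- s].

Definition trust_level (s : seq nat) : R :=
  let al := (1 + count inT s)%N in
  let be := (1 + count (fun a => ~~ inT a) s)%N in al%:R / (al + be)%:R.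

Definition apm n x := tucb_pm K H (observed (tr n x)) (U n x).
Definition chi n x := W n x < trust_level [seq e.1.1.1 | e <- tr n x].
Definition aac n x := if chi n x then apm n x else nat_of_ord (O n x).

Lemma trS n x : tr n.+1 x =
  rcons (tr n x) (apm n x, chi n x, aac n x, rew n (aac n x) x).
Proof. by rewrite /aac /chi /trust_level !count_map. Qed.

Lemma size_tr n x : size (tr n x) = n.
Proof. by elim: n => // n IH; rewrite trS size_rcons IH. Qed.

Definition disc n x := [seq e.1 | e <- tr n x].

Lemma discS n x : disc n.+1 x = rcons (disc n x) (apm n x, chi n x, aac n x).
Proof. by rewrite /disc trS map_rcons. Qed.

Lemma size_disc n x : size (disc n x) = n.
Proof. by rewrite size_map size_tr. Qed.

(* Once the discrete part [s] of a play is fixed, the full record depends on the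
   sample point through the rewards only. *)
Definition fill (s : seq (nat * bool * nat)) x : seq (nat * bool * nat * R) :=
  [seq (e.1, rew e.2 e.1.2 x) | e <- zip s (iota 0 (size s))].

Lemma fill_disc n x : fill (disc n x) x = tr n x.
Proof.
elim: n => // n IH; rewrite discS trS -[in RHS]IH /fill size_rcons -addn1 iotaD /=.
rewrite cats1 zip_rcons ?size_iota// map_rcons /= add0n size_disc.
by [].
Qed.

Lemma size_fill s x : size (fill s x) = size s.
Proof. by rewrite size_map size_zip size_iota minnn. Qed.

Lemma map_fst_fill s x : [seq e.1 | e <- fill s x] = s.
Proof.
rewrite -map_comp -[RHS](@unzip1_zip _ _ s (iota 0 (size s))) ?size_iota//.
Qed.

End Trajectory.

Section TrajectoryMeasurability.
Context (R : realType) (K H : nat) (inT : pred nat)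
  (d : measure_display) (T : measurableType d).
Variables (Rw : nat -> 'I_K -> T -> R) (W U : nat -> T -> R) (O : nat -> T -> 'I_K).

Let rewT := @rew R K T Rw.
Let fillT := @fill R K T Rw.

Lemma trust_est_ext m (o o' : seq (nat * R * bool)) :
  [seq e.2 | e <- o] = [seq e.2 | e <- o'] -> trust_est K m o = trust_est K m o'.
Proof.
move=> oo'.
have h i : (nth (0%N, 0, false) o i).2 = (nth (0%N, 0, false) o' i).2.
  have E (p : seq (nat * R * bool)) :
      (nth (0%N, 0, false) p i).2 = nth false [seq e.2 | e <- p] i.
    have [ip|ip] := ltnP i (size p); first by rewrite (nth_map (0%N, 0, false)).
    by rewrite !nth_default ?size_map.
  by rewrite !E oo'.
have hc m' s : chi_avg o m' s = chi_avg o' m' s.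
  by rewrite /chi_avg; congr (_ * _); apply: eq_bigr => i _; rewrite h.
rewrite /trust_est; congr (foldl _ _ _); apply/funext => S; apply/funext => j /=.
by rewrite !hc.
Qed.

(** The dummy reward 0 stands for values that neither the trust estimate nor the pull counts
    read. *)
Definition obs_chi (s : seq (nat * bool * nat)) : seq (nat * R * bool) :=
  [seq ((e.2, 0), e.1.2) | e <- s].

Lemma trust_est_fill m s x :
  trust_est K m (observed (fillT s x)) = trust_est K m (obs_chi s).
Proof.
apply: trust_est_ext; rewrite -[in RHS](map_fst_fill Rw s x) -/(fillT s x).
by elim: (fillT s x) => //= e t ->.
Qed.

Lemma n_ac_fill h0 s x a :
  n_ac h0 (observed (fillT s x)) a = n_ac h0 (obs_chi s) a.
Proof.
rewrite /n_ac -[in RHS](map_fst_fill Rw s x) /obs_chi -map_comp /observed.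
by rewrite -!map_drop !count_map.
Qed.

(** Restricted to the rounds before [n] because the results below are also applied to the
    sigma-algebra of a history from which the rewards of round [n] are withheld. *)
Let mRw_upto n := forall h k, (h < n)%N -> measurable_fun setT (Rw h k).

Lemma measurable_rew h a : (forall k, measurable_fun setT (Rw h k)) ->
  measurable_fun setT (rewT h a).
Proof.
by move=> mR; rewrite /rewT /rew /of_nat_arm; case: insub.
Qed.

Lemma measurable_rew_sum n h0 s a : size s = n -> mRw_upto n ->
  measurable_fun setT (fun x => rew_sum h0 (observed (fillT s x)) a).
Proof.
move=> sn mR.
rewrite (_ : (fun x => _) = fun x =>
  \sum_(e <- drop h0 (zip s (iota 0 n))) if e.1.2 == a then
     (if (e.2 < n)%N then rewT e.2 e.1.2 x else 0) else 0).
  apply: measurable_sum => e; case: (_ == a) => //; case: ltnP => // en.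
  by apply: measurable_rew => k; exact: mR.
apply/funext => x; rewrite /rew_sum /observed /fillT /fill sn -!map_drop !big_map.
rewrite big_mkcond/= !big_seq; apply: eq_bigr => e es.
suff -> : (e.2 < n)%N by [].
have /mem_drop : e \in drop h0 (zip s (iota 0 n)) by [].
move=> /(map_f snd); rewrite -/(unzip2 _) unzip2_zip ?size_iota ?sn//.
by rewrite mem_iota add0n.
Qed.

Lemma measurable_ucb n h0 s a : size s = n -> mRw_upto n ->
  measurable_fun setT (fun x => ucb H h0 (observed (fillT s x)) a).
Proof.
move=> sn mR; rewrite /ucb.
under eq_fun do rewrite n_ac_fill.
apply: measurable_minr => //; apply: measurable_funD => //.
apply: measurable_funM => //.
exact: (measurable_rew_sum _ _ sn).
Qed.

(** With the discrete record [s] frozen, the candidate set is constant and randomness enters through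
    the indices and [u] only; the list of maximisers takes countably many values and can be frozen
    in turn. *)
Lemma dmeas_tucb_pm n s u : size s = n -> mRw_upto n -> measurable_fun setT u ->
  dmeas (fun x => tucb_pm K H (observed (fillT s x)) (u x)).
Proof.
move=> sn mR mu; rewrite /tucb_pm.
under eq_fun do rewrite size_map size_fill.
under eq_fun do rewrite trust_est_fill.
case: (size s < _)%N; first exact: dmeas_cst.
pose cand := if trust_est K (m_len R K H) (obs_chi s) is [::] then iota 0 K
  else trust_est K (m_len R K H) (obs_chi s).
pose h0 := (2 * m_len R K H * K)%N.
pose mx x := \big[Num.max/0]_(a <- cand) ucb H h0 (observed (fillT s x)) a.
pose ties x := [seq a <- cand | ucb H h0 (observed (fillT s x)) a == mx x].
have mmx : measurable_fun setT mx.
  rewrite /mx; elim: (cand) => [|a c IH].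
    by rewrite (_ : (fun x => _) = fun=> 0)//; apply/funext => x; rewrite big_nil.
  under eq_fun do rewrite big_cons.
  by apply: measurable_maxr => //; exact: (measurable_ucb _ _ sn).
have mties : dmeas ties.
  apply: dmeas_filter => a; apply: dmeas_eq => //; exact: (measurable_ucb _ _ sn).
apply: (dmeas_bind (g := fun L x =>
  nth 0%N L (minn (Num.truncn (u x * (size L)%:R)) (size L).-1)) mties) => L.
apply: (dmeas_comp (fun t => nth 0%N L (minn t (size L).-1))).
by apply: dmeas_truncn; exact: measurable_funM.
Qed.

Let trT := @tr R K H inT T Rw W U O.
Let discT := @disc R K H inT T Rw W U O.
Let choice n x := (apm H inT Rw W U O n x, chi H inT Rw W U O n x, aac H inT Rw W U O n x).

Lemma dmeas_choice n : dmeas (discT n) -> mRw_upto n ->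
  measurable_fun setT (W n) -> measurable_fun setT (U n) ->
  (forall S : {set 'I_K}, measurable [set x | O n x \in S]) ->
  dmeas (choice n).
Proof.
move=> md mR mW mU mO.
pose A s x := tucb_pm K H (observed (fillT s x)) (U n x).
pose X (s : seq (nat * bool * nat)) x := W n x < trust_level R inT [seq e.1.1 | e <- s].
(* The guard on [size s] concerns frozen records of the wrong length, whose reward sums could reach
   rounds not known to be measurable; 0 is then a dummy arm. *)
have -> : choice n = fun x =>
    let s := discT n x in
    (if size s == n then A s x else 0%N, X s x,
     if X s x then (if size s == n then A s x else 0%N) else nat_of_ord (O n x)).
  apply/funext => x; rewrite /= /discT size_disc eqxx /A /X /fillT fill_disc /disc -map_comp.
  by [].
apply: (dmeas_bind (g := fun s x =>
    (if size s == n then A s x else 0%N, X s x,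
     if X s x then (if size s == n then A s x else 0%N) else nat_of_ord (O n x))) md) => s.
have mA : dmeas (fun x => if size s == n then A s x else 0%N).
  case: eqP => [sn|_]; last exact: dmeas_cst.
  exact: (dmeas_tucb_pm sn).
have mX : dmeas (X s) by exact: dmeas_lt.
have mOn : dmeas (fun x => nat_of_ord (O n x)).
  apply: (@dmeas_comp _ _ _ _ (O n) (@nat_of_ord K)).
  apply: dmeas_countP => k; have := mO [set k]%SET.
  rewrite (_ : [set x | O n x \in [set k]%SET] = [set x | O n x = k])//.
  by apply/seteqP; split => x /=; rewrite finset.inE => /eqP.
apply: (dmeas_bind (g := fun a x =>
  (a, X s x, if X s x then a else nat_of_ord (O n x))) mA) => a.
apply: (dmeas_bind (g := fun b x =>
  (a, b, if b then a else nat_of_ord (O n x))) mX) => b.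
exact: (dmeas_comp (fun o => (a, b, if b then a else o)) mOn).
Qed.

Lemma dmeas_disc n : mRw_upto n ->
  (forall h, (h < n)%N -> measurable_fun setT (W h)) ->
  (forall h, (h < n)%N -> measurable_fun setT (U h)) ->
  (forall h (S : {set 'I_K}), (h < n)%N -> measurable [set x | O h x \in S]) ->
  dmeas (discT n).
Proof.
elim: n => [|n IH] mR mW mU mO.
  by rewrite (_ : discT 0 = fun=> [::])//; exact: dmeas_cst.
have mRn : mRw_upto n by move=> h k hn; apply: mR; exact: ltnW.
have md : dmeas (discT n).
  apply: IH => //.
  - by move=> h hn; apply: mW; exact: ltnW.
  - by move=> h hn; apply: mU; exact: ltnW.
  - by move=> h S hn; apply: mO; exact: ltnW.
rewrite (_ : discT n.+1 = fun x => rcons (discT n x) (choice n x)); last first.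
  by apply/funext => x; rewrite /discT discS.
apply: (dmeas_bind (g := fun s x => rcons s (choice n x)) md) => s.
apply: (dmeas_comp (rcons s)); apply: dmeas_choice => //.
- exact: mW.
- exact: mU.
- by move=> S; exact: mO.
Qed.

End TrajectoryMeasurability.

(** * Identification of the trust set *)

Section Estimates.
Variable R : realType.
Implicit Types (c x m j k L : R).

Lemma decay_diffE c x m : 0 < x -> 0 < m ->
  c / x - c / (x + m) = c * m / (x * (x + m)).
Proof. by move=> x0 m0; field; rewrite !gt_eqF// addr_gt0. Qed.

(** The left side will dominate a pair of variances, and the difference on the right is the drift.
    The ratio of sum to difference, [(2 x + m) / m], does not involve [c]: a drift made small by a
    small minority count comes with a proportionally small variance. *)
Lemma decay_variance_le c x m k : 0 <= c -> 0 < x -> 0 < m ->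
  2 * x + m <= 4 * k * m ->
  c / x + c / (x + m) <= 4 * k * (c / x - c / (x + m)).
Proof.
move=> c0 x0 m0 h; have xm0 : 0 < x + m by lra.
rewrite decay_diffE//.
have -> : c / x + c / (x + m) = c * (2 * x + m) / (x * (x + m)).
  by field; rewrite !gt_eqF.
rewrite [leRHS]mulrA ler_pM2r ?invr_gt0 ?mulr_gt0//.
have -> : 4 * k * (c * m) = c * (4 * k * m) by ring.
by rewrite ler_wpM2l.
Qed.

Lemma decay_diff_ge c x m j : 1 <= m -> 0 <= j -> 2 * m + 1 <= c -> 0 < x ->
  x <= 2 * m * j + m + 1 ->
  (2 * (j + 1) ^+ 2)^-1 <= c / x - c / (x + m).
Proof.
move=> m1 j0 hc x0 xle.
have m0 : 0 < m by lra.
rewrite decay_diffE// ler_pdivlMr ?mulr_gt0 ?addr_gt0// mulrC ler_pdivrMr; last first.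
  by rewrite mulr_gt0// exprn_gt0//; lra.
have mj : 0 <= m * j by rewrite mulr_ge0// ltW.
have e1 : x <= 2 * m * (j + 1) by lra.
have e2 : x + m <= (2 * m + 1) * (j + 1) by lra.
apply: (@le_trans _ _ ((2 * m * (j + 1)) * ((2 * m + 1) * (j + 1)))).
  by rewrite ler_pM//; lra.
have -> : 2 * m * (j + 1) * ((2 * m + 1) * (j + 1)) =
    (2 * m + 1) * m * (2 * (j + 1) ^+ 2) by ring.
rewrite ler_wpM2r//; last by rewrite ler_wpM2r// ltW.
by rewrite mulr_ge0// sqr_ge0.
Qed.

(** All earlier blocks are frozen. For large [m] the best constant is [j / (2 j + 1)], least at
    [j = 1] where it is 1/3. The choice 83/250 is 1/750 below, and this slack absorbs the additive 1
    in the bound on [x] once [m >= 83]. *)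
Lemma decay_diff_large x m j : 83 <= m -> 1 <= j -> 0 < x ->
  x <= 2 * m * j + m + 1 ->
  83 / 250 / (j + 1) <= (2 * m * j + 1) / x - (2 * m * j + 1) / (x + m).
Proof.
move=> m83 j1 x0 xle.
have m0 : 0 < m by lra.
rewrite decay_diffE// ler_pdivlMr ?mulr_gt0 ?addr_gt0// mulrAC ler_pdivrMr; last by lra.
have mj : m <= m * j by rewrite ler_peMr// ltW.
apply: (@le_trans _ _ ((m * j) * (2 * m * (j + 1) + 1))).
  by rewrite mulrA ler_pM//; lra.
have -> : (2 * m * j + 1) * m * (j + 1) = m * j * (2 * m * (j + 1) + 1) + m by ring.
by rewrite lerDl ltW.
Qed.

(** A crude linear bound, for the expected count of the first block when its arm is not trusted. The
    last term is there to close the induction, whose step reduces to [y^2 - 7 y + 13 >= 0], a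
    quadratic with negative discriminant. *)
Lemma harmonic_le (n : nat) :
  \sum_(i < n) ((2 + i)%:R)^-1 <= n%:R / 10 + 21 / 10 * (1 - (n%:R + 1)^-1) :> R.
Proof.
elim: n => [|n IH]; first by rewrite big_ord0 mul0r !add0r invr1 subrr mulr0.
rewrite big_ord_recr/= natrD -[n.+1%:R]natr1.
have n0 : 0 <= n%:R :> R by rewrite ler0n.
move: (n%:R : R) n0 IH => y y0 IH.
apply: le_trans (lerD IH (lexx _)) _.
have e : y / 10 + 21 / 10 * (1 - (y + 1)^-1) + (2 + y)^-1 =
   y / 10 + 21 / 10 * (1 - (y + 1 + 1)^-1) +
   (10 * (y + 1) - 21) / (10 * ((y + 1) * (y + 2))).
  by field; rewrite !gt_eqF//; lra.
rewrite e -subr_ge0.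
have -> : (y + 1) / 10 + 21 / 10 * (1 - (y + 1 + 1)^-1) -
  (y / 10 + 21 / 10 * (1 - (y + 1 + 1)^-1) +
   (10 * (y + 1) - 21) / (10 * ((y + 1) * (y + 2)))) =
   ((y + 1) * (y + 2) - (10 * (y + 1) - 21)) / (10 * ((y + 1) * (y + 2))).
  by field; rewrite !gt_eqF//; lra.
have y2 := sqr_ge0 (y - 7 / 2); rewrite divr_ge0//; first by nra.
by rewrite !mulr_ge0//; lra.
Qed.

(* The margin [33/250] is [83/250 - 1/5]: the guaranteed gap of [decay_diff_large]
   minus the threshold of the algorithm. *)
Lemma exponent_large k m L (K : nat) : 0 < k <= K%:R -> (2 <= K)%N -> 0 <= L ->
  30 * K%:R ^+ 3 * L <= m ->
  m * (33 / 250 / k) ^+ 2 - 2 * (33 / 250 / k) * (33 / 250 * m / k) <= - L.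
Proof.
move=> /andP[k0 kK] K2 L0 mL.
have K2' : 2 <= K%:R :> R by rewrite ler_nat.
have -> : m * (33 / 250 / k) ^+ 2 - 2 * (33 / 250 / k) * (33 / 250 * m / k) =
  - ((33 / 250) ^+ 2 * m / k ^+ 2) by field; rewrite gt_eqF.
rewrite lerN2 ler_pdivlMr ?exprn_gt0//.
have k2 : k ^+ 2 <= K%:R ^+ 2 by rewrite ler_pXn2r ?nnegrE//; lra.
have e1 : L * k ^+ 2 <= L * K%:R ^+ 2 by rewrite ler_wpM2l.
have e2 : L * K%:R ^+ 2 * 2 <= L * K%:R ^+ 2 * K%:R.
  by rewrite ler_wpM2l// mulr_ge0// sqr_ge0.
move: (L * k ^+ 2) e1 => a e1.
have e3 : 30 * K%:R ^+ 3 * L = 30 * (L * K%:R ^+ 2 * K%:R) by ring.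
rewrite {}e3 in mL.
move: (L * K%:R ^+ 2 * K%:R) mL e2 => z mL e2.
have y0 : 0 <= L * K%:R ^+ 2 by rewrite mulr_ge0// sqr_ge0.
move: (L * K%:R ^+ 2) e1 e2 y0 => y e1 e2 y0; lra.
Qed.

(* [2 / (15 k)] balances the Bernstein term [15/16 lam^2 S], where [S <= 4 k g],
   against the drift [lam g]. *)
Lemma exponent_generic k m L (K : nat) (g S : R) : 1 <= k <= K%:R -> 0 <= L ->
  30 * K%:R ^+ 3 * L <= m -> m / (2 * k ^+ 2) <= g -> S <= 4 * k * g ->
  15 / 16 * (2 / (15 * k)) ^+ 2 * S - 2 / (15 * k) * g <= - L.
Proof.
move=> /andP[k1 kK] L0 mL gm Sg; have k0 : 0 < k by lra.
apply: (@le_trans _ _ (15 / 16 * (2 / (15 * k)) ^+ 2 * (4 * k * g) - 2 / (15 * k) * g)).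
  by rewrite lerD2r ler_wpM2l// mulr_ge0// sqr_ge0.
have -> : 15 / 16 * (2 / (15 * k)) ^+ 2 * (4 * k * g) - 2 / (15 * k) * g =
  - (g / (15 * k)) by field; rewrite gt_eqF.
rewrite lerN2 ler_pdivlMr; last by lra.
apply: le_trans gm; rewrite ler_pdivlMr; last by rewrite mulr_gt0// exprn_gt0.
apply: le_trans mL.
have -> : L * (15 * k) * (2 * k ^+ 2) = 30 * (k ^+ 3 * L) by ring.
have -> : 30 * K%:R ^+ 3 * L = 30 * (K%:R ^+ 3 * L) by ring.
rewrite ler_wpM2l// ler_wpM2r// ler_pXn2r ?nnegrE//; lra.
Qed.

Lemma exponent_small k m L (K : nat) (S : R) : 0 < k <= K%:R -> (2 <= K)%N ->
  2^-1 <= L -> 30 * K%:R ^+ 3 * L <= m -> S <= 1 ->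
  15 / 16 * 6^-1 ^+ 2 * S - 6^-1 * (m / (5 * k)) <= - L.
Proof.
move=> /andP[k0 kK] K2 L0 mL S1.
have K2' : 2 <= K%:R :> R by rewrite ler_nat.
have e : 4 * L <= m / (30 * k).
  rewrite ler_pdivlMr; last by lra.
  apply: le_trans mL.
  have -> : 4 * L * (30 * k) = (4 * k) * (30 * L) by ring.
  have -> : 30 * K%:R ^+ 3 * L = K%:R ^+ 3 * (30 * L) by ring.
  rewrite ler_wpM2r//; first by lra.
  have -> : K%:R ^+ 3 = K%:R ^+ 2 * K%:R :> R by ring.
  by rewrite ler_pM//; [lra|nra].
have -> : 6^-1 * (m / (5 * k)) = m / (30 * k) by field; rewrite gt_eqF.
lra.
Qed.

Lemma exponent_first m L (K : nat) : (2 <= K)%N -> 0 <= L ->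
  30 * K%:R ^+ 3 * L <= m -> m / 16 - m / 8 <= - L.
Proof.
move=> K2 L0 mL.
have K2' : 2 <= K%:R :> R by rewrite ler_nat.
have K8 : 8 <= K%:R ^+ 3 :> R.
  have -> : 8 = 2 ^+ 3 :> R by ring.
  by rewrite ler_pXn2r ?nnegrE//; lra.
have : 8 * L <= K%:R ^+ 3 * L by rewrite ler_wpM2r.
lra.
Qed.

End Estimates.

(** * Deterministic trust levels *)

Section IdealTrust.
Variables (R : realType) (m K : nat) (inT : pred nat).

(* Number of trusted recommendations before round [h], if every recommendation of
   the second stage is trusted; [ideal_trust h] is then the trust level [t_h]. *)
Definition ntrusted (h : nat) : nat :=
  \sum_(i < h) ((2 * m * K <= i)%N || inT (i %/ (2 * m)) : nat).

Definition ideal_trust (h : nat) : R := (1 + ntrusted h)%:R / (2 + h)%:R.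

Definition prior_trusted (j : nat) := count inT (iota 0 j).

Lemma prior_trusted_le j : (prior_trusted j <= j)%N.
Proof. by rewrite -[leqRHS](size_iota 0 j) count_size. Qed.

Lemma prior_trustedS j : prior_trusted j.+1 = (prior_trusted j + inT j)%N.
Proof. by rewrite /prior_trusted -addn1 iotaD count_cat /= addn0. Qed.

Lemma ntrustedS h : ntrusted h.+1 =
  (ntrusted h + ((2 * m * K <= h) || inT (h %/ (2 * m))))%N.
Proof. by rewrite /ntrusted big_ord_recr. Qed.

Lemma ntrusted_le h : (ntrusted h <= h)%N.
Proof.
elim: h => [|h IH]; first by rewrite /ntrusted big_ord0.
by rewrite ntrustedS; case: (_ || _); lia.
Qed.

Lemma ntrusted_block j i : (0 < m)%N -> (j < K)%N -> (i <= 2 * m)%N ->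
  ntrusted (2 * m * j + i) = (2 * m * prior_trusted j + inT j * i)%N.
Proof.
move=> m0.
have step j' i' : (j' < K)%N -> (i' <= 2 * m)%N ->
    ntrusted (2 * m * j' + i') = (ntrusted (2 * m * j') + inT j' * i')%N.
  move=> jK; elim: i' => [|i' IH] i'm; first by rewrite muln0 !addn0.
  rewrite addnS ntrustedS IH; last exact: ltnW.
  have -> : ((2 * m * j' + i') %/ (2 * m) = j')%N.
    by rewrite mulnC divnMDl ?muln_gt0// divn_small ?addn0.
  have -> : (2 * m * K <= 2 * m * j' + i')%N = false.
    apply/negbTE; rewrite -ltnNge.
    apply: (@leq_trans (2 * m * j'.+1)); last by rewrite leq_mul2l jK orbT.
    by rewrite mulnS addnC ltn_add2r.
  by case: (inT j'); rewrite /= ?mul1n ?mul0n ?addn1 ?addn0 ?addnS.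
move=> jK im; rewrite step//; congr (_ + _)%N.
elim: j jK => [|j IH] jK.
  by rewrite /prior_trusted !muln0 /ntrusted big_ord0.
have jK' := ltnW jK.
have -> : (2 * m * j.+1 = 2 * m * j + 2 * m)%N by rewrite mulnS addnC.
by rewrite step// IH// prior_trustedS mulnDr [(inT j * _)%N]mulnC.
Qed.

Lemma ntrusted_stage2 h : (2 * m * K <= h)%N ->
  ntrusted h = (ntrusted (2 * m * K) + (h - 2 * m * K))%N.
Proof.
move=> /subnKC <-; elim: (h - _)%N => [|i IH]; first by rewrite addn0 subnn addn0.
by rewrite addnS ntrustedS leq_addr/= IH; lia.
Qed.

Lemma ideal_trust01 h : 0 <= ideal_trust h <= 1.
Proof.
rewrite /ideal_trust divr_ge0//= ler_pdivrMr ?ltr0n// mul1r ler_nat.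
by have := ntrusted_le h; lia.
Qed.

(** Untrusted recommendations stop with the first stage, so there are at most [2 m K] of them. *)
Lemma ideal_trust_stage2 h : (2 * m * K <= h)%N ->
  1 - ideal_trust h <= (1 + 2 * m * K)%:R / (2 + h)%:R.
Proof.
move=> hh; rewrite /ideal_trust ntrusted_stage2//.
have h2 : (2 + h)%:R != 0 :> R by rewrite pnatr_eq0.
rewrite -[X in X - _](divff h2) -mulrBl ler_pM2r ?invr_gt0 ?ltr0n//.
rewrite lerBlDr -natrD ler_nat.
by lia.
Qed.

(* In block [j] the minority count is frozen while the total grows, so the
   probability [decay j i] of the minority outcome decreases with [i]. *)
Definition frozen j : nat :=
  (1 + 2 * m * (if inT j then j - prior_trusted j else prior_trusted j))%N.
Definition decay j i : R := (frozen j)%:R / (2 + 2 * m * j + i)%:R.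

Lemma ideal_trust_block j i : (0 < m)%N -> (j < K)%N -> (i <= 2 * m)%N ->
  ideal_trust (2 * m * j + i) = if inT j then 1 - decay j i else decay j i.
Proof.
move=> m0 jK im; rewrite /ideal_trust ntrusted_block// /decay /frozen.
rewrite addnA; have n0 : (2 + 2 * m * j + i)%:R != 0 :> R by rewrite pnatr_eq0.
case: (inT j); last by rewrite mul0n addn0.
rewrite -[X in X - _](divff n0) -mulrBl mul1n; congr (_ / _).
apply/eqP; rewrite eq_sym subr_eq -natrD eqr_nat; apply/eqP.
have := prior_trusted_le j; move: (prior_trusted j) => t tj.
have : (2 * m * t <= 2 * m * j)%N by rewrite leq_mul2l tj orbT.
by rewrite mulnBr; move: (2 * m * t)%N (2 * m * j)%N => a b; lia.
Qed.

Lemma decay01 j i : 0 <= decay j i <= 1.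
Proof.
rewrite /decay divr_ge0//= ler_pdivrMr ?ltr0n// mul1r ler_nat /frozen.
have := prior_trusted_le j; move: (prior_trusted j) => t tj.
have : (2 * m * (if inT j then j - t else t) <= 2 * m * j)%N.
  by rewrite leq_mul2l; apply/orP; right; case: (inT j); lia.
by lia.
Qed.

(** The absolute difference of the expected counts of [chi] in the two halves of block [j]: the
    drift that the tests detect. *)
Definition decay_gap j : R := \sum_(i < m) (decay j i - decay j (m + i)).

Lemma decay_natE j i : decay j i = (frozen j)%:R / (2 + 2 * m%:R * j%:R + i%:R).
Proof. by rewrite /decay !natrD !natrM. Qed.

Lemma decay_shiftE j i : decay j (m + i) =
  (frozen j)%:R / (2 + 2 * m%:R * j%:R + i%:R + m%:R).
Proof. by rewrite decay_natE natrD; congr (_ / _); ring. Qed.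

Let pos j (i : nat) : 0 < 2 + 2 * m%:R * j%:R + i%:R :> R.
Proof. by rewrite -!natrM -!natrD ltr0n. Qed.

Lemma decay_gap_ge0 j : (0 < m)%N -> 0 <= decay_gap j.
Proof.
move=> m0; apply: sumr_ge0 => i _; rewrite decay_natE decay_shiftE.
by rewrite decay_diffE ?ltr0n ?pos// divr_ge0// mulr_ge0// ?addr_ge0// ltW// pos.
Qed.

Lemma decay_sum_le j : (2 <= m)%N ->
  \sum_(i < m) decay j i + \sum_(i < m) decay j (m + i) <= 4 * j.+1%:R * decay_gap j.
Proof.
move=> m2; rewrite /decay_gap mulr_sumr -big_split/=; apply: ler_sum => i _.
rewrite decay_natE decay_shiftE; apply: decay_variance_le => //.
  by rewrite ltr0n; lia.
rewrite -natr1.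
have im : i%:R + 1 <= m%:R :> R by rewrite natr1 ler_nat.
have m2' : 2 <= m%:R :> R by rewrite ler_nat.
have : 0 <= m%:R * j%:R :> R by rewrite mulr_ge0.
by lra.
Qed.

Lemma decay_gap_generic j : (0 < m)%N -> (2 * m + 1 <= frozen j)%N ->
  m%:R / (2 * j.+1%:R ^+ 2) <= decay_gap j.
Proof.
move=> m0 fr; rewrite /decay_gap.
apply: (@le_trans _ _ (\sum_(i < m) (2 * (j%:R + 1) ^+ 2)^-1)).
  by rewrite sumr_const card_ord natr1 mulr_natl.
apply: ler_sum => i _; rewrite decay_natE decay_shiftE.
apply: decay_diff_ge => //.
- by rewrite ler1n.
- by rewrite -natrM natr1 ler_nat -addn1.
- have im : i%:R + 1 <= m%:R :> R by rewrite natr1 ler_nat.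
  by lra.
Qed.

Lemma decay_gap_large j : (83 <= m)%N -> (0 < j)%N -> frozen j = (1 + 2 * m * j)%N ->
  83 / 250 * m%:R / j.+1%:R <= decay_gap j.
Proof.
move=> m0 j0 fr; rewrite /decay_gap.
apply: (@le_trans _ _ (\sum_(i < m) (83 / 250 / (j%:R + 1)))).
  by rewrite sumr_const card_ord natr1 -[leRHS]mulr_natr mulrAC.
apply: ler_sum => i _; rewrite decay_natE decay_shiftE fr.
have -> : (1 + 2 * m * j)%:R = 2 * m%:R * j%:R + 1 :> R.
  by rewrite natrD !natrM addrC.
apply: decay_diff_large => //.
- by rewrite ler_nat.
- by rewrite ler1n.
- have im : i%:R + 1 <= m%:R :> R by rewrite natr1 ler_nat.
  by lra.
Qed.

Lemma decay_sum_small j : (0 < m)%N -> (0 < j)%N -> frozen j = 1%N ->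
  \sum_(i < m) decay j i + \sum_(i < m) decay j (m + i) <= 1.
Proof.
move=> m0 j0 fr.
have D i : decay j i <= (2 * m%:R)^-1.
  rewrite /decay fr mul1r -natrM lef_pV2 ?posrE ?ltr0n ?muln_gt0//.
  rewrite ler_nat; have : (2 * m <= 2 * m * j)%N by rewrite leq_pmulr.
  by lia.
apply: (@le_trans _ _ (\sum_(i < m) (2 * m%:R)^-1 + \sum_(i < m) (2 * m%:R)^-1)).
  by apply: lerD; apply: ler_sum.
rewrite !sumr_const card_ord -mulr_natr.
have mn0 : m%:R != 0 :> R by rewrite pnatr_eq0; lia.
by rewrite le_eqVlt; apply/orP; left; apply/eqP; field.
Qed.

Lemma decay_var j i : (0 < m)%N -> (j < K)%N -> (i <= 2 * m)%N ->
  ideal_trust (2 * m * j + i) * (1 - ideal_trust (2 * m * j + i)) <= decay j i.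
Proof.
move=> m0 jK im; rewrite ideal_trust_block//; have /andP[a b] := decay01 j i.
case: (inT j).
  by rewrite subKr ler_piMl//; lra.
by rewrite ler_piMr//; lra.
Qed.

End IdealTrust.

Section BlockStatistics.
Variables (R : realType) (K m : nat) (inT : pred nat) (T : Type) (W : nat -> T -> R).

(** What [chi_avg] computes when the trust levels are the ideal ones. *)
Definition block_freq c x : R := (m%:R)^-1 *
  \sum_(i < m) (W (c + i)%N x < ideal_trust R m K inT (c + i)%N)%R%:R.

(* The test of [trust_est] for arm [j] when the current set has [sz] elements. *)
Definition accept (j sz : nat) (y1 y2 : R) : bool :=
  if j == 0%N then 2^-1 <= y1 + y2
  else (if sz == 0%N then (5 * (j.+1)%:R)^-1
        else if sz == j then - (5 * (j.+1)%:R)^-1 else 0) <= y2 - y1.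

End BlockStatistics.

(** * Error probability of each test *)

Section Stage1.
Context (R : realType) (K H : nat) (d : measure_display) (T : measurableType d)
  (P : probability T R).
Variables (Rw : nat -> 'I_K -> T -> R) (W U : nat -> T -> R) (O : nat -> T -> 'I_K).
Hypothesis mRw : forall h k, measurable_fun setT (Rw h k).
Hypothesis mW : forall h, measurable_fun setT (W h).
Hypothesis mU : forall h, measurable_fun setT (U h).
Hypothesis mO : forall h (S : {set 'I_K}), measurable [set x | O h x \in S].
Hypothesis indep : independent_rounds P Rw W U O.
Hypothesis W_law : forall h (y : R), 0 <= y <= 1 ->
  P (W h @^-1` [set z | z < y]) = y%:E.
Variables (m : nat) (inT : pred nat).
Hypothesis K2 : (2 <= K)%N.
Hypothesis H2 : (2 <= H)%N.
Hypothesis m120 : (120 <= m)%N.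
Hypothesis mL : 30 * K%:R ^+ 3 * ln H%:R <= m%:R :> R.

Let q := @ideal_trust R m K inT.
Let Z h x : R := (W h x < q h)%R%:R.
(** With this sign the mean of [s j * block_diff j] is minus the drift whichever way the trust
    moves, so an upper tail covers both cases. *)
Let s j : R := if inT j then -1 else 1.
Definition block_diff j x : R :=
  \sum_(i < m) Z (2 * m * j + m + i) x - \sum_(i < m) Z (2 * m * j + i) x.

Let L12 : 2^-1 <= ln H%:R :> R.
Proof.
apply: (le_trans (ln2_ge_half R)); rewrite ler_ln ?posrE ?ltr0n ?ler_nat//.
by lia.
Qed.

Let L0 : 0 <= ln H%:R :> R.
Proof. by apply: le_trans L12; rewrite invr_ge0. Qed.

Let HV : (H%:R)^-1 = expR (- ln H%:R) :> R.
Proof. by rewrite expRN lnK// posrE ltr0n; lia. Qed.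

Let m0 : (0 < m)%N. Proof. by lia. Qed.

Let le_invH (e : R) (E : set T) : (P E <= (expR e)%:E)%E -> e <= - ln H%:R ->
  (P E <= ((H%:R)^-1)%:E)%E.
Proof. by move=> PE eL; apply: le_trans PE _; rewrite lee_fin HV ler_expR. Qed.

(** [lam] is the Chernoff parameter, [theta] the tolerated deviation and [v] bounds the log-moments.
    The half-blocks carry weights of opposite signs, which is why [t] ranges over both values of
    modulus [lam]. *)
Let block_dev j (lam theta : R) (v : nat -> R) : (j < K)%N -> 0 < lam ->
  (forall i, (i < 2 * m)%N -> forall t, `|t| = lam ->
     bern_mgf (q (2 * m * j + i)%N) t <= expR (v i)) ->
  \sum_(i < m) v i + \sum_(i < m) v (m + i)%N - lam * theta <= - ln H%:R ->
  exists E : set T, [/\ measurable E, (P E <= ((H%:R)^-1)%:E)%E &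
    forall x, ~ E x -> s j * block_diff j x < theta - decay_gap R m inT j].
Proof.
move=> jK lam0 hv he.
have s1 : `|s j| = 1 by rewrite /s; case: (inT j); rewrite ?normrN1 ?normr1.
have ss : s j * s j = 1 by rewrite /s; case: (inT j); ring.
have q01 h : 0 <= q h <= 1 by exact: ideal_trust01.
pose v' h := v (h - 2 * m * j)%N.
have v1 i : v' (2 * m * j + i)%N = v i by rewrite /v' addKn.
have v2 i : v' (2 * m * j + m + i)%N = v (m + i)%N by rewrite /v' -addnA addKn.
have [||E [mE PE hE]] := @block_tail _ _ _ _ P Rw W U O mRw mW mU mO indep W_law
  (2 * m * j) m q v' (- s j * lam) (s j * lam) (lam * theta) q01.
- move=> i im; rewrite v1; apply: hv; first by lia.
  by rewrite normrM normrN s1 mul1r gtr0_norm.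
- move=> i im; rewrite v2 -addnA; apply: hv; first by lia.
  by rewrite normrM s1 mul1r gtr0_norm.
exists E; split => //.
- apply: le_invH PE _.
  under eq_bigr do rewrite v1.
  by under [X in _ + X - _]eq_bigr do rewrite v2.
- move=> x /hE.
  rewrite !sumrB.
  set Q1 := \sum_(i < m) q _; set Q2 := \sum_(i < m) q _.
  rewrite -/(Z _ x).
  have Q12 : Q2 - Q1 = - s j * decay_gap R m inT j.
    rewrite /Q1 /Q2 -sumrB /decay_gap mulr_sumr; apply: eq_bigr => i _.
    have im := ltn_ord i.
    rewrite -addnA /q !ideal_trust_block//; try lia.
    by rewrite /s; case: (inT j); ring.
  rewrite /block_diff /Z.
  set Z1 := \sum_(i < m) _; set Z2 := \sum_(i < m) _ => h.
  have {}h : lam * (s j * (Z2 - Z1) - s j * (Q2 - Q1)) < lam * theta.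
    apply: le_lt_trans h; rewrite le_eqVlt; apply/orP; left; apply/eqP; ring.
  rewrite ltr_pM2l// Q12 in h.
  have e : s j * (- s j * decay_gap R m inT j) = - decay_gap R m inT j.
    by rewrite mulNr mulrN mulrA ss mul1r.
  rewrite e in h; lra.
Qed.

Let bernstein_block j (lam : R) : (j < K)%N -> 0 < lam <= 6^-1 ->
  (forall i, (i < 2 * m)%N -> forall t, `|t| = lam ->
     bern_mgf (q (2 * m * j + i)%N) t <= expR (15 / 16 * lam ^+ 2 * decay R m inT j i)).
Proof.
move=> jK /andP[lam0 lam6] i im t tl.
have q01 : 0 <= q (2 * m * j + i) <= 1 by exact: ideal_trust01.
apply: le_trans (bern_mgf_bernstein q01 _) _; first by rewrite tl.
rewrite ler_expR -[t ^+ 2]real_normK ?num_real// tl ler_wpM2l//.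
  by rewrite mulr_ge0// sqr_ge0.
by apply: decay_var => //; exact: ltnW.
Qed.

Let kK j : (j < K)%N -> 0 < (j.+1%:R : R) <= K%:R.
Proof. by move=> jK; rewrite ltr0n ler_nat. Qed.

Let block_generic j : (j < K)%N -> (2 * m + 1 <= frozen m inT j)%N ->
  exists E : set T, [/\ measurable E, (P E <= ((H%:R)^-1)%:E)%E &
    forall x, ~ E x -> s j * block_diff j x < 0].
Proof.
move=> jK fr; have k0 : 0 < j.+1%:R :> R by rewrite ltr0n.
have k1 : 1 <= j.+1%:R :> R by rewrite ler1n.
have lam0 : 0 < 2 / (15 * j.+1%:R) :> R by rewrite divr_gt0// mulr_gt0.
(* The threshold is 0, so the whole drift may be spent on the deviation. *)
have [||E [mE PE hE]] := @block_dev j (2 / (15 * j.+1%:R)) (decay_gap R m inT j)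
  _ jK lam0 (bernstein_block jK _).
- rewrite lam0 /= ler_pdivrMr ?mulr_gt0//; lra.
- rewrite -[X in X + _ - _]mulr_sumr -[X in _ + X - _]mulr_sumr -mulrDr.
  apply: (exponent_generic _ L0 mL).
  + by rewrite k1 ler_nat.
  + exact: decay_gap_generic.
  + by apply: decay_sum_le; lia.
by exists E; split => // x /hE; rewrite subrr.
Qed.

Let block_small j : (0 < j)%N -> (j < K)%N -> frozen m inT j = 1%N ->
  exists E : set T, [/\ measurable E, (P E <= ((H%:R)^-1)%:E)%E &
    forall x, ~ E x -> s j * block_diff j x < m%:R / (5 * j.+1%:R)].
Proof.
move=> j0 jK fr.
have l6 : 0 < (6^-1 : R) <= 6^-1 by lra.
have l60 : 0 < 6^-1 :> R by lra.
(* The drift may be negligible here. It is discarded, and the margin is the threshold [1 / (5 k)],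
   which is [m / (5 k)] in counts. *)
have [|E [mE PE hE]] := @block_dev j 6^-1 (m%:R / (5 * j.+1%:R))
  _ jK l60 (bernstein_block jK l6).
  rewrite -[X in X + _ - _]mulr_sumr -[X in _ + X - _]mulr_sumr -mulrDr.
  apply: (exponent_small (kK jK) K2 L12 mL).
  exact: decay_sum_small.
exists E; split => // x /hE /lt_le_trans; apply.
by rewrite gerBl decay_gap_ge0.
Qed.

Let block_large j : (0 < j)%N -> (j < K)%N -> frozen m inT j = (1 + 2 * m * j)%N ->
  exists E : set T, [/\ measurable E, (P E <= ((H%:R)^-1)%:E)%E &
    forall x, ~ E x -> s j * block_diff j x < - (m%:R / (5 * j.+1%:R))].
Proof.
move=> j0 jK fr; have k0 : 0 < j.+1%:R :> R by rewrite ltr0n.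
have lam0 : 0 < 2 * (33 / 250 / j.+1%:R) :> R by rewrite mulr_gt0// divr_gt0//; lra.
(* For [theta = 33/250 * m / k], the exponent [m lam^2 / 4 - lam theta] is least at
   [lam = 2 theta / m]. *)
have [||E [mE PE hE]] := @block_dev j (2 * (33 / 250 / j.+1%:R))
  (33 / 250 * m%:R / j.+1%:R) (fun=> (2 * (33 / 250 / j.+1%:R)) ^+ 2 / 8) jK lam0.
- move=> i im t tl; rewrite -tl real_normK ?num_real//.
  by apply: bern_mgf_hoeffding; exact: ideal_trust01.
- rewrite !sumr_const card_ord.
  apply: le_trans (exponent_large (kK jK) K2 L0 mL).
  rewrite -(mulr_natr (_ / 8) m) le_eqVlt; apply/orP; left; apply/eqP; field.
  by rewrite gt_eqF.
exists E; split => // x /hE /lt_le_trans; apply.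
have h := @decay_gap_large R m inT j (leq_trans (isT : 83 <= 120)%N m120) j0 fr.
have e : 83 / 250 * m%:R / j.+1%:R - 33 / 250 * m%:R / j.+1%:R =
  m%:R / (5 * j.+1%:R) :> R by field; rewrite gt_eqF.
by rewrite -e opprB lerB.
Qed.

Let freq := block_freq K m inT W.

Let M0 : 0 < m%:R :> R. Proof. by rewrite ltr0n. Qed.

(** With no earlier arm there is no shift to rely on, and the total count over the [2 m] rounds is
    compared with [m / 2]. Weights 1/2 and tail level [m / 8] let it deviate by [m / 4]; its mean is
    at least [m] for a trusted arm, at most [m / 5 + 21/10] otherwise. *)
Let block_first : exists E : set T, [/\ measurable E, (P E <= ((H%:R)^-1)%:E)%E &
  forall x, ~ E x -> accept 0 0 (freq 0 x) (freq m x) = inT 0].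
Proof.
have q01 h : 0 <= q h <= 1 by exact: ideal_trust01.
have lam0 : 0 < 2^-1 :> R by lra.
have mgf h t : `|t| = 2^-1 -> bern_mgf (q h) t <= expR (2^-1 ^+ 2 / 8).
  move=> tl; rewrite -tl real_normK ?num_real//; exact: bern_mgf_hoeffding.
have s1 : `|s 0 * 2^-1| = 2^-1.
  by rewrite normrM /s; case: (inT 0); rewrite ?normrN1 ?normr1 mul1r gtr0_norm.
have [||E [mE PE hE]] := @block_tail _ _ _ _ P Rw W U O mRw mW mU mO indep W_law
  0 m q (fun=> 2^-1 ^+ 2 / 8) (s 0 * 2^-1) (s 0 * 2^-1) (m%:R / 8) q01.
- by move=> i _; exact: mgf.
- by move=> i _; exact: mgf.
exists E; split => //.
- apply: le_invH PE _; rewrite !sumr_const card_ord.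
  apply: le_trans (exponent_first K2 L0 mL).
  rewrite -(mulr_natr (_ / 8) m) le_eqVlt; by apply/orP; left; apply/eqP; field.
- move=> x /hE; rewrite !add0n !sumrB.
  set Q1 := \sum_(i < m) q _; set Q2 := \sum_(i < m) q _.
  have K0 : (0 < K)%N by lia.
  have fr : frozen m inT 0 = 1%N by rewrite /frozen /prior_trusted; case: (inT 0); rewrite muln0.
  have qE i : (i <= 2 * m)%N -> q i = if inT 0 then 1 - ((2 + i)%:R)^-1 else ((2 + i)%:R)^-1.
    move=> im; have := @ideal_trust_block R m K inT 0 i m0 K0 im.
    by rewrite muln0 add0n /q => ->; rewrite /decay fr muln0 addn0 mul1r.
  have Q12 : Q1 + Q2 = \sum_(i < m + m) q i by rewrite big_split_ord.
  rewrite /accept /freq /block_freq /= -/q.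
  set Z1 := \sum_(i < m) _; set Z2 := \sum_(i < m) _ => h.
  rewrite -mulrDr -ler_pdivrMl ?invr_gt0// invrK.
  have M120 : 120 <= m%:R :> R by rewrite ler_nat.
  move: h qE; rewrite /s; case: (inT 0) => h qE.
    have : \sum_(i < m + m) 2^-1 <= \sum_(i < m + m) q i.
      apply: ler_sum => i _; rewrite qE; last by have := ltn_ord i; lia.
      have : ((2 + i)%:R)^-1 <= 2^-1 :> R.
        by rewrite lef_pV2 ?posrE ?ltr0n// ler_nat leq_addr.
      by lra.
    rewrite sumr_const card_ord -Q12 -(mulr_natr 2^-1) natrD => hQ.
    by apply/idP; lra.
  have : \sum_(i < m + m) q i = \sum_(i < m + m) ((2 + i)%:R)^-1.
    by apply: eq_bigr => i _; rewrite qE//; have := ltn_ord i; lia.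
  rewrite -Q12 => hQ; have := harmonic_le R (m + m).
  rewrite -hQ natrD => hl.
  have : 0 < (m%:R + m%:R + 1)^-1 :> R by rewrite invr_gt0; lra.
  move: ((m%:R + m%:R + 1)^-1) hl => z hl z0.
  apply/negbTE; rewrite -ltNge; lra.
Qed.

(** If the earlier arms have mixed statuses, the sign of the shift decides. If they all have the
    same status, an arm that shares it hardly moves the trust level and, fluctuations included,
    stays on its side of the threshold, while an arm of the other status moves it by more than
    [1 / (5 k)]; hence the shifted thresholds in these two cases. *)
Lemma block_decides j : (j < K)%N ->
  exists E : set T, [/\ measurable E, (P E <= ((H%:R)^-1)%:E)%E &
  forall x, ~ E x -> accept j (prior_trusted inT j)
    (freq (2 * m * j) x) (freq (2 * m * j + m) x) = inT j].
Proof.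
case: j => [|j] jK; first by rewrite muln0 add0n; exact: block_first.
have j0 : (0 < j.+1)%N by [].
have k5 : 0 < 5 * j.+2%:R :> R by rewrite mulr_gt0.
have yE x : freq (2 * m * j.+1 + m) x - freq (2 * m * j.+1) x =
    (m%:R)^-1 * block_diff j.+1 x by rewrite -mulrBr.
have tj := prior_trusted_le inT j.+1.
have acceptE x c : (c <= (m%:R)^-1 * block_diff j.+1 x) =
    (c * m%:R <= block_diff j.+1 x).
  by rewrite mulrC ler_pdivlMr.
have neg (c : R) : - c^-1 * m%:R = - (m%:R / c) by rewrite mulNr mulrC.
rewrite /accept /=.
have [t0|t0] := eqVneq (prior_trusted inT j.+1) 0%N.
  case Tj: (inT j.+1).
    have [|E [mE PE hE]] := @block_large j.+1 j0 jK.
      by rewrite /frozen Tj t0 subn0.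
    exists E; split => // x /hE; rewrite /s Tj yE acceptE [_^-1 * _]mulrC.
    move: (m%:R / _) => z h.
    by apply/idP; lra.
  have [|E [mE PE hE]] := @block_small j.+1 j0 jK.
    by rewrite /frozen Tj t0 muln0.
  exists E; split => // x /hE; rewrite /s Tj yE acceptE [_^-1 * _]mulrC.
    move: (m%:R / _) => z h.
  by apply/negbTE; rewrite -ltNge; lra.
have [tT|tT] := eqVneq (prior_trusted inT j.+1) j.+1.
  case Tj: (inT j.+1).
    have [|E [mE PE hE]] := @block_small j.+1 j0 jK.
      by rewrite /frozen Tj tT subnn muln0.
    exists E; split => // x /hE; rewrite /s Tj yE acceptE neg.
    move: (m%:R / _) => z h.
    by apply/idP; lra.
  have [|E [mE PE hE]] := @block_large j.+1 j0 jK.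
    by rewrite /frozen Tj tT.
  exists E; split => // x /hE; rewrite /s Tj yE acceptE neg.
    move: (m%:R / _) => z h.
  by apply/negbTE; rewrite -ltNge; lra.
have [|E [mE PE hE]] := @block_generic j.+1 jK.
  rewrite /frozen addnC leq_add2l -{1}[(2 * m)%N]muln1 leq_mul2l.
  by apply/orP; right; case: (inT j.+1); lia.
exists E; split => // x /hE; rewrite /s yE acceptE mul0r.
case: (inT j.+1) => h; first by apply/idP; lra.
by apply/negbTE; rewrite -ltNge; lra.
Qed.

End Stage1.

(** * The second stage along a play *)

Section UcbEstimates.
Variable R : realType.

Lemma ucb_confidence (N : nat) (S L r : R) : 2^-1 <= L -> 0 <= r <= 1 ->
  (N = 0%N -> S = 0) ->
  ((0 < N)%N -> `|S - N%:R * r| <= 2 * (N%:R * Num.sqrt (L / N%:R))) ->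
  let u := Num.min 1 (S / (maxn 1 N)%:R + 2 * Num.sqrt (L / (maxn 1 N)%:R)) in
  r <= u <= r + 4 * Num.sqrt (L / (maxn 1 N)%:R).
Proof.
move=> L2 /andP[r0 r1] S0 hS /=.
case: N S0 hS => [|N] S0 hS.
  (* An arm never pulled has empirical mean 0, but its radius is at least 1 because [sqrt L >= 1/2]:
     the truncated index is 1. *)
  rewrite S0// maxn0 !divr1 add0r.
  have sL : 2^-1 <= Num.sqrt L.
    have -> : 2^-1 = Num.sqrt (2^-1 ^+ 2) :> R by rewrite sqrtr_sqr ger0_norm.
    by apply: ler_wsqrtr; lra.
  rewrite le_min r1 /= ge_min; apply/andP; split; first by lra.
  by apply/orP; left; lra.
have -> : maxn 1 N.+1 = N.+1 by rewrite (maxn_idPr _).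
have := hS isT; set n : R := N.+1%:R; set w := Num.sqrt _ => h.
have n0 : 0 < n by rewrite ltr0n.
have -> : S = n * (r + (S - n * r) / n) by field; rewrite gt_eqF.
rewrite [n * _]mulrC mulfK ?gt_eqF//.
have : `|(S - n * r) / n| <= 2 * w.
  by rewrite normrM normfV (gtr0_norm n0) ler_pdivrMr// -mulrA [w * n]mulrC.
rewrite ler_norml; move: (_ / n) => z /andP[z1 z2].
rewrite le_min r1 /= ge_min; apply/andP; split; first by lra.
by apply/orP; right; lra.
Qed.

(** For [N >= 1], squaring reduces this to [2/3 + 1 / (9 N) <= 1]. The coefficient 1/3 is the origin
    of the factor 3 in the potential bound. *)
Lemma sqrt_increment (N : nat) :
  Num.sqrt N%:R + 3^-1 / Num.sqrt (maxn 1 N)%:R <= Num.sqrt N.+1%:R :> R.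
Proof.
case: N => [|N]; first by rewrite maxn0 sqrtr0 sqrtr1 divr1 add0r; lra.
have -> : maxn 1 N.+1 = N.+1 by rewrite (maxn_idPr _).
set y := Num.sqrt N.+1%:R.
have y2 : y ^+ 2 = N.+1%:R by rewrite sqr_sqrtr.
have y1 : 1 <= y by rewrite /y -[leLHS]sqrtr1 ler_wsqrtr// ler1n.
have y0 : 0 < y by lra.
have -> : y + 3^-1 / y = Num.sqrt ((y + 3^-1 / y) ^+ 2).
  by rewrite sqrtr_sqr ger0_norm// addr_ge0 ?divr_ge0// ltW.
apply: ler_wsqrtr; rewrite -[N.+2%:R]natr1 -y2.
have -> : (y + 3^-1 / y) ^+ 2 = y ^+ 2 + (2 / 3 + 9^-1 * (y ^+ 2)^-1).
  by field; rewrite gt_eqF.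
rewrite lerD2l.
have : (y ^+ 2)^-1 <= 1 by rewrite invf_le1 ?exprn_gt0// exprn_ege1.
move: ((y ^+ 2)^-1) => z; lra.
Qed.

Lemma sum_sqrt_le (K H : nat) (N : 'I_K -> nat) : (0 < K)%N -> (0 < H)%N ->
  (\sum_(k < K) N k <= H)%N ->
  \sum_(k < K) Num.sqrt (N k)%:R <= Num.sqrt (K%:R * H%:R) :> R.
Proof.
move=> K0 H0 hN.
have K0' : 0 < K%:R :> R by rewrite ltr0n.
have H0' : 0 < H%:R :> R by rewrite ltr0n.
pose c : R := Num.sqrt (H%:R / K%:R).
have c0 : 0 < c by rewrite sqrtr_gt0 divr_gt0.
have c2 : c ^+ 2 = H%:R / K%:R by rewrite sqr_sqrtr// divr_ge0.
have -> : Num.sqrt (K%:R * H%:R) = K%:R * c :> R.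
  rewrite -[in RHS](@ger0_norm _ K%:R)// -sqrtr_sqr -sqrtrM ?sqr_ge0//.
  by congr Num.sqrt; field; rewrite gt_eqF.
(* AM-GM with the weight that balances the two sums *)
have amgm k : Num.sqrt (N k)%:R <= 2^-1 * ((N k)%:R / c + c) :> R.
  set y := Num.sqrt _; have -> : (N k)%:R = y ^+ 2 :> R by rewrite sqr_sqrtr.
  rewrite -subr_ge0.
  have -> : 2^-1 * (y ^+ 2 / c + c) - y = (y - c) ^+ 2 / (2 * c).
    by field; rewrite gt_eqF.
  by rewrite divr_ge0 ?sqr_ge0// mulr_ge0// ltW.
apply: le_trans (ler_sum _ (fun k _ => amgm k)) _.
rewrite -mulr_sumr big_split/= sumr_const card_ord -mulr_suml -natr_sum.
apply: (@le_trans _ _ (2^-1 * (H%:R / c + c *+ K))).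
  by rewrite ler_wpM2l// lerD2r ler_wpM2r ?invr_ge0 ?ler_nat// ltW.
rewrite -(mulr_natl c).
have -> : H%:R / c = K%:R * c.
  have -> : H%:R = K%:R * c ^+ 2 :> R by rewrite c2; field; rewrite gt_eqF.
  by field; rewrite gt_eqF.
lra.
Qed.

Lemma bigmax_mem (I : eqType) (s : seq I) (f : I -> R) : s != [::] ->
  (forall a, 0 <= f a) -> exists2 a, a \in s & f a = \big[Num.max/0]_(b <- s) f b.
Proof.
move=> s0 f0; elim: s s0 => // a [|b s] IH _.
  by exists a; rewrite ?mem_head// big_cons big_nil max_l.
have [//|c cs ce] := IH.
rewrite big_cons -ce; have [fac|fca] := leP (f a) (f c).
  by exists c => //; rewrite inE cs orbT.
by exists a => //; rewrite mem_head.
Qed.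

Lemma le_bigmax_mem (I : eqType) (s : seq I) (f : I -> R) a : a \in s ->
  f a <= \big[Num.max/0]_(b <- s) f b.
Proof.
elim: s => // b s IH; rewrite inE big_cons le_max => /predU1P[->|/IH ->].
  by rewrite lexx.
by rewrite orbT.
Qed.

End UcbEstimates.

(** * Comparison with the deterministic trust along one sample point *)

Section Path.
Context (R : realType) (K H : nat) (inT : pred nat) (T : Type).
Variables (Rw : nat -> 'I_K -> T -> R) (W U : nat -> T -> R) (O : nat -> T -> 'I_K).
Hypothesis Rw01 : forall h k x, 0 <= Rw h k x <= 1.
Hypothesis H2 : (2 <= H)%N.

Variable m : nat.
Hypothesis mE : m_len R K H = m.
Let h0 := (2 * m * K)%N.
Hypothesis m0 : (0 < m)%N.

Let q := @ideal_trust R m K inT.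
Let trT := @tr R K H inT T Rw W U O.
Let apmT := @apm R K H inT T Rw W U O.
Let chiT := @chi R K H inT T Rw W U O.
Let aacT := @aac R K H inT T Rw W U O.
Let pms n x := [seq e.1.1.1 | e <- trT n x].

Lemma pmsS n x : pms n.+1 x = rcons (pms n x) (apmT n x).
Proof. by rewrite /pms /trT trS map_rcons. Qed.

Lemma nth_chi n i x : (i < n)%N ->
  (nth (0%N, 0, false) (observed (trT n x)) i).2 = chiT i x.
Proof.
elim: n => // n IH; rewrite ltnS leq_eqVlt /trT trS /observed map_rcons nth_rcons.
rewrite size_map size_tr => /predU1P[->|lt_in]; first by rewrite ltnn eqxx.
by rewrite lt_in; exact: IH.
Qed.

Lemma chi_ideal n x : count inT (pms n x) = ntrusted m K inT n ->
  chiT n x = (W n x < q n).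
Proof.
move=> E; rewrite /chiT /chi /trust_level -/(pms n x) E /q /ideal_trust.
have := count_predC inT (pms n x); rewrite E size_map size_tr /predC.
rewrite (@eq_count _ _ (fun a => ~~ inT a))// => E2.
by congr (_ < _ / _%:R); lia.
Qed.

Lemma apm_stage1 n x : (n < h0)%N -> apmT n x = (n %/ (2 * m))%N.
Proof. by move=> nh; rewrite /apmT /apm /tucb_pm size_map size_tr mE nh. Qed.

Lemma pms_stage1 n x : (n <= h0)%N -> count inT (pms n x) = ntrusted m K inT n.
Proof.
elim: n => [|n IH] nh; first by rewrite /ntrusted big_ord0.
rewrite pmsS -cats1 count_cat /= addn0 (IH (ltnW nh)) apm_stage1// ntrustedS.
by rewrite [(_ <= n)%N]leqNgt nh.
Qed.

Let freq := block_freq K m inT W.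

Definition good_trust x := forall j, (j < K)%N ->
  accept j (prior_trusted inT j) (freq (2 * m * j) x) (freq (2 * m * j + m) x) = inT j.

Lemma chi_avg_freq n c x : (h0 <= n)%N -> (c + m <= h0)%N ->
  chi_avg (observed (trT n x)) m c = freq c x.
Proof.
move=> nh ch; rewrite /chi_avg /freq /block_freq; congr (_ * _).
apply: eq_bigr => i _; have ci : (c + i < h0)%N.
  by apply: leq_trans ch; rewrite ltn_add2l.
by rewrite nth_chi ?(leq_trans ci)// chi_ideal// pms_stage1// ltnW.
Qed.

(** Induction over the arms: when the estimate is right for the arms before [j], its size is
    [prior_trusted inT j], so the test performed is the one that [good_trust] assumes to succeed. *)
Lemma trust_est_good n x : good_trust x -> (h0 <= n)%N ->
  trust_est K m (observed (trT n x)) = [seq a <- iota 0 K | inT a].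
Proof.
move=> gx nh; rewrite /trust_est.
suff : forall k, (k <= K)%N -> foldl (fun S j =>
     let y1 := chi_avg (observed (trT n x)) m (2 * m * j) in
     let y2 := chi_avg (observed (trT n x)) m (2 * m * j + m) in
     if j == 0%N then (if (2%:R)^-1 <= y1 + y2 then rcons S j else S)
     else
       let lam : R :=
         if size S == 0%N then (5 * (j.+1)%:R)^-1
         else if size S == j then - (5 * (j.+1)%:R)^-1 else 0 in
       if lam <= y2 - y1 then rcons S j else S) [::] (iota 0 k) =
   [seq a <- iota 0 k | inT a] by apply.
elim=> // j IH jK.
have -> : iota 0 j.+1 = iota 0 j ++ [:: j] by rewrite -addn1 iotaD.
rewrite foldl_cat filter_cat IH; last exact: ltnW.
rewrite [foldl _ _ [:: j]]/= [[seq a <- [:: j] | inT a]]/=.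
have b1 : (2 * m * j + m + m <= h0)%N.
  rewrite -addnA addnn -mul2n addnC -mulnS /h0 leq_mul2l jK orbT//.
rewrite !chi_avg_freq//; last by rewrite (leq_trans _ b1)// leq_addr.
have := gx j jK; rewrite /accept size_filter -/(prior_trusted inT j).
by case: (j == 0%N) => ->; case: (inT j); rewrite ?cats1 ?cats0.
Qed.

Let L : R := ln H%:R.

Let L12 : 2^-1 <= L.
Proof.
apply: (le_trans (ln2_ge_half R)); rewrite ler_ln ?posrE ?ltr0n ?ler_nat//.
by lia.
Qed.

Let L0 : 0 <= L.
Proof. by apply: le_trans L12; rewrite invr_ge0. Qed.

Lemma rew01 h a x : 0 <= rew Rw h a x <= 1.
Proof. by rewrite /rew /of_nat_arm; case: insub => //; rewrite lexx ler01. Qed.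

Definition pulls n a x :=
  count (fun e : nat * bool * nat * R => e.1.2 == a) (drop h0 (trT n x)).
Definition gains n a x : R := \sum_(e <- drop h0 (trT n x) | e.1.2 == a) e.2.

Let dropS n x : (h0 <= n)%N -> drop h0 (trT n.+1 x) =
  rcons (drop h0 (trT n x)) (apmT n x, chiT n x, aacT n x, rew Rw n (aacT n x) x).
Proof. by move=> nh; rewrite /trT trS drop_rcons// size_tr. Qed.

Let drop_stage1 n x : (n <= h0)%N -> drop h0 (trT n x) = [::].
Proof. by move=> nh; rewrite drop_oversize// size_tr. Qed.

Lemma pulls0 n a x : (n <= h0)%N -> pulls n a x = 0%N.
Proof. by move=> nh; rewrite /pulls drop_stage1. Qed.

Lemma gains0 n a x : (n <= h0)%N -> gains n a x = 0.
Proof. by move=> nh; rewrite /gains drop_stage1// big_nil. Qed.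

Lemma pullsS n a x : (h0 <= n)%N -> pulls n.+1 a x = (pulls n a x + (aacT n x == a))%N.
Proof. by move=> nh; rewrite /pulls dropS// -cats1 count_cat /= addn0. Qed.

Lemma gainsS n a x : (h0 <= n)%N ->
  gains n.+1 a x = gains n a x + (if aacT n x == a then rew Rw n a x else 0).
Proof.
move=> nh; rewrite /gains dropS// -cats1 big_cat big_cons big_nil /= addr0.
by case: eqP => [->|_].
Qed.

Lemma gains_ge0 n a x : 0 <= gains n a x.
Proof.
elim: n => [|n IH]; first by rewrite gains0.
have [nh|nh] := leqP h0 n; last by rewrite gains0.
rewrite gainsS// addr_ge0//; case: ifP => // _.
by case/andP: (rew01 n a x).
Qed.

Lemma gains_no_pull n a x : pulls n a x = 0%N -> gains n a x = 0.
Proof.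
elim: n => [|n IH]; first by rewrite gains0.
have [nh|nh] := leqP h0 n; last by rewrite gains0.
rewrite pullsS// gainsS//; case: eqP => _; first by rewrite addn1.
by rewrite addn0 addr0.
Qed.

Let ucbT n a x := ucb H h0 (observed (trT n x)) a.

Lemma ucbE n a x : ucbT n a x =
  Num.min 1 (gains n a x / (maxn 1 (pulls n a x))%:R
             + 2 * Num.sqrt (L / (maxn 1 (pulls n a x))%:R)).
Proof.
rewrite /ucbT /ucb /n_ac /rew_sum /observed -map_drop count_map big_map.
by [].
Qed.

Lemma ucb_ge0 n a x : 0 <= ucbT n a x.
Proof.
by rewrite ucbE le_min ler01 addr_ge0// ?divr_ge0 ?gains_ge0.
Qed.

Lemma apm_stage2 n x : good_trust x -> (h0 <= n)%N ->
  (exists2 k, (k < K)%N & inT k) ->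
  [/\ inT (apmT n x), (apmT n x < K)%N &
   forall a, (a < K)%N -> inT a -> ucbT n a x <= ucbT n (apmT n x) x].
Proof.
move=> gx nh [k0 k0K Tk0].
set cand := [seq a <- iota 0 K | inT a].
have kc : k0 \in cand by rewrite mem_filter Tk0 mem_iota.
have cand0 : cand != [::] by case: (cand) kc.
pose mx := \big[Num.max/0]_(a <- cand) ucbT n a x.
pose ties := [seq a <- cand | ucbT n a x == mx].
have [b bc be] := @bigmax_mem R _ cand (fun a => ucbT n a x) cand0 (fun a => ucb_ge0 n a x).
have bt : b \in ties by rewrite mem_filter be eqxx.
have apmE : apmT n x \in ties.
  rewrite /apmT /apm /tucb_pm size_map size_tr mE -/h0 ltnNge nh /=.
  rewrite -/(trT n x) trust_est_good// -/cand.
  have -> : (if cand is [::] then iota 0 K else cand) = cand by case: (cand) cand0.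
  (* [minn] clips the index, so the recommendation lies in [ties] for every value of the
     tie-breaking variable. *)
  rewrite mem_nth// -/ties.
  have : (0 < size ties)%N by case: (ties) bt.
  rewrite -/(ucbT n _ x) -/mx -/ties.
  by move=> s0; rewrite (leq_ltn_trans (geq_minr _ _))// prednK.
move: apmE; rewrite !mem_filter mem_iota /= => /and3P[/eqP e T1 T2].
split => // a aK Ta; rewrite e; apply: (le_bigmax_mem (fun a => ucbT n a x)).
by rewrite mem_filter Ta mem_iota.
Qed.

Lemma pms_good n x : good_trust x -> (exists2 k, (k < K)%N & inT k) ->
  count inT (pms n x) = ntrusted m K inT n.
Proof.
move=> gx Tx; elim: n => [|n IH]; first exact: pms_stage1.
have [nh|nh] := leqP h0 n; last exact: pms_stage1.
rewrite pmsS -cats1 count_cat /= addn0 IH ntrustedS -/h0 nh /=.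
by have [-> _ _] := apm_stage2 gx nh Tx.
Qed.

Variable r : 'I_K -> R.
Hypothesis r01 : forall k, 0 <= r k <= 1.
Let rr := of_nat_arm r.

Lemma of_nat_arm01 a : 0 <= rr a <= 1.
Proof. by rewrite /rr /of_nat_arm; case: insub => //; rewrite lexx ler01. Qed.

Lemma of_nat_arm_ord (k : 'I_K) : rr k = r k.
Proof. by rewrite /rr /of_nat_arm valK. Qed.

Lemma opt_rew_ge k : r k <= opt_rew r.
Proof. exact: (@le_bigmax_mem R _ (index_enum _) r k (mem_index_enum k)). Qed.

Lemma opt_rew01 : 0 <= opt_rew r <= 1.
Proof.
rewrite /opt_rew; elim/big_ind: _ => //; first by rewrite lexx ler01.
by move=> u v u01 v01; case: (leP u v).
Qed.

Lemma gap01 a : 0 <= opt_rew r - rr a <= 1.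
Proof.
have /andP[a0 a1] := of_nat_arm01 a; have /andP[p0 p1] := opt_rew01.
apply/andP; split; last by lra.
rewrite subr_ge0 /rr /of_nat_arm; case: insub => [k|//].
exact: opt_rew_ge.
Qed.

Definition regret_upto n x : R := \sum_(e <- trT n x) (opt_rew r - rr e.1.2).

Lemma regret_uptoS n x :
  regret_upto n.+1 x = regret_upto n x + (opt_rew r - rr (aacT n x)).
Proof. by rewrite /regret_upto /trT trS -cats1 big_cat big_seq1. Qed.

Lemma regret_upto_ge0 n x : 0 <= regret_upto n x.
Proof. by apply: sumr_ge0 => e _; case/andP: (gap01 e.1.2). Qed.

Lemma regret_upto_le n x : regret_upto n x <= n%:R.
Proof.
elim: n => [|n IH]; first by rewrite /regret_upto big_nil.
rewrite regret_uptoS -natr1 lerD//.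
by case/andP: (gap01 (aacT n x)).
Qed.

Definition good_means x := forall n a, (n <= H)%N -> (a < K)%N -> (0 < pulls n a x)%N ->
  `|gains n a x - (pulls n a x)%:R * rr a| <=
  2 * ((pulls n a x)%:R * Num.sqrt (L / (pulls n a x)%:R)).

(** Optimism: with [k] a trusted optimal arm, [a] the recommended arm and [w] the value
    [sqrt (L / N)] for arm [a], one has [r k <= ucb k <= ucb a <= r a + 4 w]. *)
Lemma gap_stage2 n x : good_trust x -> good_means x -> (h0 <= n)%N -> (n <= H)%N ->
  (exists2 k, inT (nat_of_ord k) & r k = opt_rew r) -> chiT n x ->
  opt_rew r - rr (aacT n x) <=
  4 * Num.sqrt (L / (maxn 1 (pulls n (aacT n x) x))%:R).
Proof.
move=> gt gm nh nH [k Tk rk] cx.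
have Tx : exists2 k, (k < K)%N & inT k by exists k.
have [T1 aK amax] := apm_stage2 gt nh Tx.
have -> : aacT n x = apmT n x by rewrite /aacT /aac -/(chiT n x) cx.
have conf a : (a < K)%N -> rr a <= ucbT n a x <=
    rr a + 4 * Num.sqrt (L / (maxn 1 (pulls n a x))%:R).
  move=> aK'; rewrite ucbE; apply: ucb_confidence => //.
  - exact: of_nat_arm01.
  - exact: gains_no_pull.
  - by move=> p0; exact: gm.
have /andP[_ h1] := conf _ aK.
have /andP[h2 _] := conf _ (ltn_ord k).
have h3 := amax _ (ltn_ord k) Tk.
rewrite of_nat_arm_ord rk in h2.
lra.
Qed.

Definition potential n x : R := \sum_(k < K) Num.sqrt (pulls n k x)%:R.

Lemma potential_nd n x : potential n x <= potential n.+1 x.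
Proof.
apply: ler_sum => k _; have [nh|nh] := leqP h0 n; last by rewrite !pulls0// ltnW.
by rewrite pullsS// ler_wsqrtr// ler_nat leq_addr.
Qed.

Lemma potential_step n x : (h0 <= n)%N -> (aacT n x < K)%N ->
  potential n x + 3^-1 / Num.sqrt (maxn 1 (pulls n (aacT n x) x))%:R <=
  potential n.+1 x.
Proof.
move=> nh aK; pose a := Ordinal aK.
rewrite /potential (bigD1 a)//= [leRHS](bigD1 a)//= addrAC lerD//.
  by rewrite pullsS// eqxx addn1 sqrt_increment.
apply: ler_sum => k _.
by rewrite pullsS// ler_wsqrtr// ler_nat leq_addr.
Qed.

Lemma regret_good n x : good_trust x -> good_means x -> (n <= H)%N ->
  (exists2 k, inT (nat_of_ord k) & r k = opt_rew r) ->
  regret_upto n x <= h0%:R + \sum_(i < n) ((h0 <= i)%N && (q i <= W i x))%:R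
    + 12 * Num.sqrt L * potential n x.
Proof.
move=> gt gm nH opt.
have Tx : exists2 k, (k < K)%N & inT k by case: opt => k Tk _; exists k.
have sL := sqrtr_ge0 L.
(* The form suited to induction: [minn n h0] charges 1 for each first-stage round played so far. *)
suff : regret_upto n x <= (minn n h0)%:R + \sum_(i < n) ((h0 <= i)%N && (q i <= W i x))%:R
    + 12 * Num.sqrt L * potential n x.
  move=> h; apply: le_trans h _; rewrite !lerD2r ler_nat; exact: geq_minr.
elim: n nH => [|n IH] nH.
  rewrite /regret_upto big_nil big_ord0 addr0 addr_ge0// mulr_ge0//.
  by apply: sumr_ge0 => k _; exact: sqrtr_ge0.
have {}IH := IH (ltnW nH).
have /andP[g0 g1] := gap01 (aacT n x).
rewrite regret_uptoS big_ord_recr/=.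
have pn := ler_wpM2l (_ : 0 <= 12 * Num.sqrt L) (potential_nd n x).
have {}pn := pn (mulr_ge0 (ler0n _ _) sL).
have [nh|nh] := leqP h0 n; last first.
  rewrite /= addr0.
  have -> : minn n.+1 h0 = n.+1 by rewrite (minn_idPl _).
  have En : minn n h0 = n by rewrite (minn_idPl _)// ltnW.
  rewrite En in IH; rewrite -natr1; lra.
have -> : minn n.+1 h0 = h0 by rewrite (minn_idPr _)// ltnW.
have En : minn n h0 = h0 by rewrite (minn_idPr _).
rewrite En in IH.
have cE : chiT n x = (W n x < q n) by apply: chi_ideal; exact: pms_good.
have [qW|Wq] /= := leP (q n) (W n x); first by lra.
have cx : chiT n x by rewrite cE.
have gs := gap_stage2 gt gm nh (ltnW nH) opt cx.
have aK : (aacT n x < K)%N.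
  rewrite /aacT /aac -/(chiT n x) cx.
  by have [] := apm_stage2 gt nh Tx.
(* A gap of [4 sqrt (L / N)] is paid by [12 sqrt L] times the increase [1 / (3 sqrt N)] of the
   potential. *)
have := ler_wpM2l (mulr_ge0 (ler0n R 12) sL) (potential_step nh aK).
rewrite sqrtrM// in gs.
rewrite sqrtrV in gs; last by rewrite ler0n.
move: (Num.sqrt (maxn _ _)%:R) gs => y gs.
have -> : 12 * Num.sqrt L * (potential n x + 3^-1 / y) =
  12 * Num.sqrt L * potential n x + 4 * (Num.sqrt L / y).
  by rewrite mulrDr; congr (_ + _); rewrite mulrA; lra.
move: gs; move: (Num.sqrt L / y) => z gs; lra.
Qed.

Lemma sum_pulls_le n x : (\sum_(k < K) pulls n (nat_of_ord k) x <= n)%N.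
Proof.
elim: n => [|n IH]; first by rewrite big1// => k _; rewrite pulls0.
have [nh|nh] := leqP h0 n; last by rewrite big1// => k _; rewrite pulls0.
under eq_bigr do rewrite pullsS//.
rewrite big_split/= -addn1 leq_add//.
have [aK|aK] := ltnP (aacT n x) K; last first.
  rewrite big1// => k _; apply/eqP; rewrite eqb0; apply/eqP => e.
  by move: (ltn_ord k); rewrite -e ltnNge aK.
rewrite (bigD1 (Ordinal aK))//= eqxx big1// => k kn.
apply/eqP; rewrite eqb0; apply: contra kn => /eqP e.
by apply/eqP/val_inj.
Qed.

Lemma regret_good_final x : (0 < K)%N -> good_trust x -> good_means x ->
  (exists2 k, inT (nat_of_ord k) & r k = opt_rew r) ->
  regret_upto H x <= h0%:R + \sum_(i < H) ((h0 <= i)%N && (q i <= W i x))%:R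
    + 12 * Num.sqrt (K%:R * H%:R * L).
Proof.
move=> K0 gt gm opt; apply: le_trans (regret_good gt gm (leqnn H) opt) _.
rewrite lerD2l -mulrA ler_wpM2l// [_ * L]mulrC sqrtrM//.
rewrite ler_wpM2l ?sqrtr_ge0// sum_sqrt_le//; first by lia.
exact: sum_pulls_le.
Qed.

End Path.

(** * Concentration of the empirical means *)

Section LogMart.
Context (R : realType) (K H : nat) (inT : pred nat) (T : Type).
Variables (Rw : nat -> 'I_K -> T -> R) (W U : nat -> T -> R) (O : nat -> T -> 'I_K).
Variables (m : nat) (r : 'I_K -> R).

Definition log_mart (lam : R) n (a : 'I_K) x : R :=
  lam * (gains H inT Rw W U O m n a x - (pulls H inT Rw W U O m n a x)%:R * r a)
  - lam ^+ 2 / 8 * (pulls H inT Rw W U O m n a x)%:R.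

Lemma log_mart_stage1 lam n a x : (n <= 2 * m * K)%N -> log_mart lam n a x = 0.
Proof.
move=> nh; rewrite /log_mart gains0// pulls0//.
by rewrite mul0r subrr !mulr0 subrr.
Qed.

Lemma log_martS lam n a x : (2 * m * K <= n)%N ->
  log_mart lam n.+1 a x = log_mart lam n a x +
  (if aac H inT Rw W U O n x == a then lam * (Rw n a x - r a) - lam ^+ 2 / 8 else 0).
Proof.
move=> nh; rewrite /log_mart gainsS// pullsS// natrD.
have -> : rew Rw n a x = Rw n a x by rewrite /rew /of_nat_arm valK.
by case: (aac H inT Rw W U O n x == a) => /=; ring.
Qed.

Lemma pulls_le n a x : (pulls H inT Rw W U O m n a x <= n)%N.
Proof.
apply: leq_trans (count_size _ _) _.
by rewrite size_drop size_tr leq_subr.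
Qed.

End LogMart.

Section LogMartingale.
Context (R : realType) (K H : nat) (inT : pred nat)
  (d : measure_display) (T : measurableType d).
Variables (Rw : nat -> 'I_K -> T -> R) (W U : nat -> T -> R) (O : nat -> T -> 'I_K).
Variables (m : nat).

Lemma measurable_pulls n a : dmeas (disc H inT Rw W U O n) ->
  measurable_fun setT (fun x => (pulls H inT Rw W U O m n a x)%:R : R).
Proof.
move=> md; rewrite (_ : (fun x => _) = fun x => (count (fun e => e.2 == a)
  (drop (2 * m * K) (disc H inT Rw W U O n x)))%:R).
  exact: (measurable_bind (g := fun s _ =>
    (count (fun e : nat * bool * nat => e.2 == a) (drop (2 * m * K) s))%:R) md).
by apply/funext => x; rewrite /pulls /disc -map_drop count_map.
Qed.

Lemma measurable_gains n a : dmeas (disc H inT Rw W U O n) ->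
  (forall h k, (h < n)%N -> measurable_fun setT (Rw h k)) ->
  measurable_fun setT (gains H inT Rw W U O m n a).
Proof.
move=> md mR; pose g s x : R := if size s == n then
  rew_sum (2 * m * K) (observed (fill Rw s x)) a else 0.
rewrite (_ : gains _ _ _ _ _ _ _ _ _ = fun x => g (disc H inT Rw W U O n x) x).
  apply: (measurable_bind md) => s; rewrite /g; case: eqP => // sn.
  exact: (measurable_rew_sum _ _ sn).
apply/funext => x; rewrite /g size_disc eqxx fill_disc /gains /rew_sum /observed.
by rewrite -map_drop big_map.
Qed.

Variable r : 'I_K -> R.
Let log_mart := log_mart H inT Rw W U O m r.

(** Stated without a probability measure, so that the domain can also carry the sigma-algebra of a
    history. *)
Lemma measurable_log_mart lam n a : dmeas (disc H inT Rw W U O n) ->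
  (forall h k, (h < n)%N -> measurable_fun setT (Rw h k)) ->
  measurable_fun setT (log_mart lam n a).
Proof.
move=> md mR; have mp := measurable_pulls a md; have mg := measurable_gains a md mR.
apply: measurable_funB; last exact: measurable_funM.
apply: measurable_funM => //; apply: measurable_funB => //.
exact: measurable_funM.
Qed.

End LogMartingale.

Section Martingale.
Context (R : realType) (K H : nat) (inT : pred nat)
  (d : measure_display) (T : measurableType d) (P : probability T R).
Variables (Rw : nat -> 'I_K -> T -> R) (W U : nat -> T -> R) (O : nat -> T -> 'I_K).
Hypothesis mRw : forall h k, measurable_fun setT (Rw h k).
Hypothesis mW : forall h, measurable_fun setT (W h).
Hypothesis mU : forall h, measurable_fun setT (U h).
Hypothesis mO : forall h (S : {set 'I_K}), measurable [set x | O h x \in S].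
Hypothesis indep : independent_rounds P Rw W U O.
Hypothesis Rw01 : forall h k x, 0 <= Rw h k x <= 1.
Hypothesis ident : forall h (B : 'I_K -> set R), (forall k, measurable (B k)) ->
     P (\bigcap_(k in [set: 'I_K]) (Rw h k @^-1` B k))
     = P (\bigcap_(k in [set: 'I_K]) (Rw 0%N k @^-1` B k)).

Let r := mean_rew P Rw.

Lemma Rw_law h a B : measurable B -> P (Rw h a @^-1` B) = P (Rw 0%N a @^-1` B).
Proof.
move=> mB; have E h' : Rw h' a @^-1` B =
    \bigcap_(k in [set: 'I_K]) (Rw h' k @^-1` (if k == a then B else setT)).
  apply/seteqP; split=> x; last by move=> /(_ a I); rewrite /= eqxx.
  by move=> Bx k _ /=; case: eqP => // ->.
by rewrite E ident -?E// => k; case: ifP.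
Qed.

Lemma integral_Rw_law h a (f : R -> \bar R) : measurable_fun setT f ->
  (forall y, 0 <= f y)%E -> (\int[P]_x f (Rw h a x) = \int[P]_x f (Rw 0%N a x))%E.
Proof.
move=> mf f0.
pose X h' : {mfun T >-> R} := HB.pack (Rw h' a) (isMeasurableFun.Build _ _ _ _ _ (mRw h' a)).
have E h' : (\int[P]_x f (Rw h' a x) = \int[distribution P (X h')]_y f y)%E.
  by rewrite ge0_integral_distribution.
rewrite !E; apply: eq_measure_integral => A mA _; exact: Rw_law.
Qed.

Let mERw h a : measurable_fun setT (fun x => (Rw h a x)%:E).
Proof. exact/measurable_EFinP. Qed.

Let int1 : (\int[P]_x (1 : R)%:E = 1)%E.
Proof. by rewrite integral_cst// mul1e; exact: probability_setT. Qed.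

Let int_Rw_le1 a : (\int[P]_x (Rw 0%N a x)%:E <= 1)%E.
Proof.
rewrite -int1; apply: ge0_le_integral => //.
- by move=> x _; rewrite lee_fin; case/andP: (Rw01 0 a x).
- by move=> x _; rewrite lee_fin; case/andP: (Rw01 0 a x).
Qed.

Let int_Rw_ge0 a : (0 <= \int[P]_x (Rw 0%N a x)%:E)%E.
Proof.
by apply: integral_ge0 => x _; rewrite lee_fin; case/andP: (Rw01 0 a x).
Qed.

Lemma integral_Rw a : (\int[P]_x (Rw 0%N a x)%:E = (r a)%:E)%E.
Proof.
rewrite /r /mean_rew fineK// ge0_fin_numE//.
exact: le_lt_trans (int_Rw_le1 a) (ltry _).
Qed.

Lemma mean_rew01 a : 0 <= r a <= 1.
Proof. by rewrite -!lee_fin -integral_Rw int_Rw_ge0 int_Rw_le1. Qed.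

Let integral_1Rw a : (\int[P]_x (1 - Rw 0%N a x)%:E = (1 - r a)%:E)%E.
Proof.
have E : (\int[P]_x (1 - Rw 0%N a x)%:E + (r a)%:E = 1)%E.
  rewrite -integral_Rw -ge0_integralD//.
  - rewrite -[RHS]int1; apply: eq_integral => x _.
    by rewrite -EFinD subrK.
  - by move=> x _; rewrite lee_fin subr_ge0; case/andP: (Rw01 0 a x).
  - by apply/measurable_EFinP; exact: measurable_funB.
  - by move=> x _; rewrite lee_fin; case/andP: (Rw01 0 a x).
by rewrite EFinB -E addeK.
Qed.

(** On [[0,1]] the exponential lies below its chord, which replaces the reward by a Bernoulli
    variable of the same mean. *)
Lemma hoeffding_Rw n a (lam : R) :
  (\int[P]_x (expR (lam * (Rw n a x - r a) - lam ^+ 2 / 8))%:E <= 1)%E.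
Proof.
pose f y := (expR (lam * (y - r a) - lam ^+ 2 / 8))%:E.
have mf : measurable_fun setT f.
  apply/measurable_EFinP; apply: measurableT_comp => //.
  apply: measurable_funB => //; apply: measurable_funM => //.
  exact: measurable_funB.
rewrite (integral_Rw_law n a mf); last by move=> y; rewrite lee_fin expR_ge0.
pose c := expR (- (lam * r a) - lam ^+ 2 / 8).
have c0 : 0 <= c by exact: expR_ge0.
have e0 : 0 <= c * expR lam by rewrite mulr_ge0// expR_ge0.
apply: (@le_trans _ _ (\int[P]_x ((c%:E * (1 - Rw 0%N a x)%:E) +
    ((c * expR lam)%:E * (Rw 0%N a x)%:E)))%E).
  apply: ge0_le_integral => //.
  - by move=> x _; rewrite lee_fin expR_ge0.
  - exact: measurableT_comp mf (mRw 0 a).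
  - apply/measurable_EFinP; apply: measurable_funD; apply: measurable_funM => //.
    exact: measurable_funB.
  - move=> x _; rewrite /f -!EFinM -EFinD lee_fin.
    have -> : lam * (Rw 0 a x - r a) - lam ^+ 2 / 8 =
      (- (lam * r a) - lam ^+ 2 / 8) + lam * Rw 0 a x by ring.
    rewrite expRD -/c -mulrA -mulrDr ler_wpM2l//.
    have := expR_chord lam (Rw01 0 a x).
    by rewrite [expR lam * _]mulrC.
have p1 x : (0 <= (1 - Rw 0%N a x)%:E :> \bar R)%E.
  by rewrite lee_fin subr_ge0; case/andP: (Rw01 0 a x).
have p2 x : (0 <= (Rw 0%N a x)%:E :> \bar R)%E.
  by rewrite lee_fin; case/andP: (Rw01 0 a x).
have m1 : measurable_fun setT (fun x => (1 - Rw 0%N a x)%:E).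
  by apply/measurable_EFinP; exact: measurable_funB.
rewrite ge0_integralD//; last 4 first.
- by move=> x _; rewrite mule_ge0// lee_fin.
- exact: measurable_funeM.
- by move=> x _; rewrite mule_ge0// lee_fin.
- exact: measurable_funeM.
rewrite !ge0_integralZl// integral_1Rw integral_Rw -!EFinM -EFinD lee_fin.
rewrite -mulrA -mulrDr.
have h := hoeffding_two_point lam (mean_rew01 a).
rewrite [leRHS](_ : _ = c * expR (r a * lam + lam ^+ 2 / 8)); last first.
  by rewrite /c -expRD (_ : _ + _ = 0) ?expR0//; ring.
by rewrite ler_wpM2l// [expR lam * _]mulrC.
Qed.

Variable m : nat.
Let lmart := log_mart H inT Rw W U O m r.
Let aacT := aac H inT Rw W U O.

Let mdisc n : dmeas (disc H inT Rw W U O n).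
Proof. by apply: dmeas_disc. Qed.

Lemma measurable_log_martT lam n a : measurable_fun setT (lmart lam n a).
Proof. by apply: measurable_log_mart. Qed.

Lemma dmeas_aac n : dmeas (aacT n).
Proof.
have := @dmeas_choice R K H inT d T Rw W U O n (mdisc n) (fun h k _ => mRw h k)
  (mW n) (mU n) (mO n).
exact: (dmeas_comp snd).
Qed.

(* The increment at round [n] is independent of the past and of the arm pulled at
   round [n], and its exponential moment is at most 1. *)
Lemma exp_mart_le1 lam n (a : 'I_K) : (\int[P]_x (expR (lmart lam n a x))%:E <= 1)%E.
Proof.
elim: n => [|n IH].
  under eq_integral do rewrite /lmart log_mart_stage1// expR0.
  by rewrite int1.
have [nh|nh] := leqP (2 * m * K) n; last first.
  under eq_integral do rewrite /lmart log_mart_stage1// expR0.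
  by rewrite int1.
(* Everything up to round [n] except the rewards of round [n]. *)
pose G := history Rw W U O n.+1 (fun h => h != n).
pose TG := g_sigma_algebraType G.
have GRw h k : (h < n)%N -> measurable_fun setT (Rw h k : TG -> R).
  by move=> hn; apply: history_measurable_Rw; [exact: ltnW|rewrite neq_ltn hn].
have GW h : (h < n.+1)%N -> measurable_fun setT (W h : TG -> R).
  exact: history_measurable_W.
have GU h : (h < n.+1)%N -> measurable_fun setT (U h : TG -> R).
  exact: history_measurable_U.
have GO h (S : {set 'I_K}) : (h < n.+1)%N -> measurable ([set x | O h x \in S] : set TG).
  exact: history_measurable_O.
have Gdisc : @dmeas _ TG _ (disc H inT Rw W U O n).
  apply: (@dmeas_disc R K H inT _ TG) => //.
  - by move=> h hn; apply: GW; exact: ltnW.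
  - by move=> h hn; apply: GU; exact: ltnW.
  - by move=> h S hn; apply: GO; exact: ltnW.
have Glm : measurable_fun setT (lmart lam n a : TG -> R).
  exact: (@measurable_log_mart R K H inT _ TG).
have Gaac : @dmeas _ TG _ (aacT n).
  have := @dmeas_choice R K H inT _ TG Rw W U O n Gdisc GRw
    (GW n (ltnSn n)) (GU n (ltnSn n)) (fun S => GO n S (ltnSn n)).
  exact: (dmeas_comp snd).
pose b x : R := (aacT n x == a)%:R.
pose f x : \bar R := (expR (lmart lam n a x) * b x)%:E.
pose f' x : \bar R := (expR (lmart lam n a x) * (1 - b x))%:E.
pose g (y : R) : \bar R := (expR (lam * (y - r a) - lam ^+ 2 / 8))%:E.
have b01 x : 0 <= b x <= 1 by rewrite /b ler0n lern1 leq_b1.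
have f0 x : (0 <= f x)%E.
  by rewrite lee_fin mulr_ge0 ?expR_ge0//; case/andP: (b01 x).
have f'0 x : (0 <= f' x)%E.
  by rewrite lee_fin mulr_ge0 ?expR_ge0// subr_ge0; case/andP: (b01 x).
have g0 y : (0 <= g y)%E by rewrite lee_fin expR_ge0.
have mg : measurable_fun setT g.
  apply/measurable_EFinP; apply: measurableT_comp => //.
  apply: measurable_funB => //; apply: measurable_funM => //.
  exact: measurable_funB.
have Gf : measurable_fun setT (f : TG -> \bar R).
  apply/measurable_EFinP; apply: measurable_funM.
    exact: measurableT_comp.
  exact: (@measurable_bind _ TG R nat (aacT n) (fun (s : nat) _ => (s == a)%:R) Gaac).
have mb : measurable_fun setT b.
  exact: (@measurable_bind _ T R nat (aacT n) (fun (s : nat) _ => (s == a)%:R) (dmeas_aac n)).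
have me : measurable_fun setT (fun x => expR (lmart lam n a x)).
  by apply: measurableT_comp => //; exact: measurable_log_martT.
have mf : measurable_fun setT f.
  by apply/measurable_EFinP; exact: measurable_funM.
have mf' : measurable_fun setT f'.
  by apply/measurable_EFinP; apply: measurable_funM => //; exact: measurable_funB.
have mgR : measurable_fun setT (fun x => g (Rw n a x)).
  exact: measurableT_comp.
(* [f] and [f'] are the parts of the exponential on and off the event that [a] is pulled at round
   [n]; only the first acquires the new factor [g]. *)
have -> : (\int[P]_x (expR (lmart lam n.+1 a x))%:E =
    \int[P]_x (f' x + f x * g (Rw n a x)))%E.
  apply: eq_integral => x _; rewrite /lmart log_martS// expRD /f' /f /g /b.
  rewrite -EFinM -EFinD; congr (_%:E).
  rewrite -/(lmart lam n a x) -/(aacT n x).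
  by case: (aacT n x == a); rewrite ?expR0 /=; ring.
rewrite ge0_integralD//; last 2 first.
- by move=> x _; exact: mule_ge0.
- exact: emeasurable_funM.
rewrite (integral_history_Rw mRw mW mU mO indep a Gf mg f0 g0).
apply: le_trans IH.
have -> : (\int[P]_x (expR (lmart lam n a x))%:E = \int[P]_x (f' x + f x))%E.
  by apply: eq_integral => x _; rewrite /f /f' -EFinD -mulrDr subrK mulr1.
rewrite ge0_integralD// leeD2l// -[leRHS]mule1 lee_wpmul2l//.
  exact: integral_ge0.
exact: hoeffding_Rw.
Qed.

Lemma log_mart_tail lam n (a : 'I_K) (c : R) :
  (P [set x | (c <= lmart lam n a x)%R] <= (expR (- c))%:E)%E.
Proof.
apply: le_trans (markov_expR P c (measurable_log_martT lam n a)) _.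
under eq_integral do rewrite addrC expRD EFinM.
rewrite ge0_integralZl//; last first.
  by apply/measurable_EFinP; apply: measurableT_comp => //; exact: measurable_log_martT.
by rewrite -[leRHS]mule1 lee_wpmul2l// exp_mart_le1.
Qed.

Lemma union_bound (I : Type) (s : seq I) (A : I -> set T) (c : R) :
  (forall i, measurable (A i)) -> (forall i, (P (A i) <= c%:E)%E) ->
  (P (\big[setU/set0]_(i <- s) A i) <= ((size s)%:R * c)%:E)%E.
Proof.
move=> mA PA; elim: s => [|i s IH]; first by rewrite big_nil measure0 mul0r.
rewrite big_cons; apply: le_trans (measureU2 _ _ _) _ => //.
  exact: bigsetU_measurable.
by rewrite /= -natr1 mulrDl mul1r addrC EFinD leeD.
Qed.

Hypothesis H2 : (2 <= H)%N.

Let L : R := ln H%:R.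

Let expL (n : nat) : expR (- (n%:R * L)) = (H%:R ^+ n)^-1.
Proof.
by rewrite expRN expRM_natl lnK// posrE ltr0n; lia.
Qed.

(** Indexed by a round, a number of pulls [N = p.+1], an arm and a sign. [lam] must be constant
    while the number of pulls is random, so it is tuned to each possible [N]: a deviation [2 N w]
    with [w = sqrt (L / N)] has its best parameter at [lam = 8 w], where the exponent is
    [16 L - 8 L = 8 L]. *)
Definition deviation (w : 'I_H.+1 * 'I_H * 'I_K * bool) : set T :=
  let: (n, p, a, b) := w in
  [set x | 8 * L <= lmart ((-1) ^+ b * (8 * Num.sqrt (L / p.+1%:R))) n a x].

Lemma good_means_off_deviation x : (forall w, ~ deviation w x) ->
  good_means H inT Rw W U O m r x.
Proof.
move=> hd n a nH aK; set p := pulls _ _ _ _ _ _ _ _ _ _.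
set S := gains _ _ _ _ _ _ _ _ _ _ => p0.
have pH : (p.-1 < H)%N.
  by rewrite prednK//; exact: leq_trans (pulls_le _ _ _ _ _ _ _ _ _ _) nH.
have nH' : (n < H.+1)%N by [].
rewrite leNgt; apply/negP => hS.
pose w := Num.sqrt (L / p%:R).
have pp : 0 < p%:R :> R by rewrite ltr0n.
have L0 : 0 <= L by rewrite ln_ge0// ler1n; lia.
have w2 : p%:R * w ^+ 2 = L.
  by rewrite sqr_sqrtr ?divr_ge0// mulrC divfK// gt_eqF.
have w0 : 0 <= w by exact: sqrtr_ge0.
have ra : of_nat_arm r a = r (Ordinal aK) by exact: (of_nat_arm_ord r (Ordinal aK)).
rewrite ra -/w in hS.
pose z := S - p%:R * r (Ordinal aK).
apply: (hd (Ordinal nH', Ordinal pH, Ordinal aK, z < 0)).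
rewrite /deviation /= prednK// -/w /lmart /log_mart /= -/p -/S -/z.
have -> : ((-1) ^+ (z < 0)%R * (8 * w)) * z = 8 * (w * `|z|) .
  have [z0|z0] := ltP z 0; first by rewrite ltr0_norm// expr1; ring.
  by rewrite ger0_norm// expr0; ring.
have -> : ((-1) ^+ (z < 0)%R * (8 * w)) ^+ 2 / 8 * p%:R = 8 * (p%:R * w ^+ 2).
  by rewrite exprMn sqrr_sign; field.
rewrite w2; have := ler_wpM2l w0 (ltW hS); rewrite -/z.
have -> : w * (2 * (p%:R * w)) = 2 * (p%:R * w ^+ 2) by ring.
rewrite w2; move: (w * _) => y; lra.
Qed.

Lemma deviation_measurable w : measurable (deviation w).
Proof.
case: w => [[[n p] a] b]; rewrite -[X in measurable X]setTI.
apply: measurable_fun_le => //; exact: measurable_log_martT.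
Qed.

Lemma deviation_prob w : (P (deviation w) <= ((H%:R ^+ 8)^-1)%:E)%E.
Proof.
case: w => [[[n p] a] b]; rewrite -expL; exact: log_mart_tail.
Qed.

End Martingale.

(** * The regret bound *)

Lemma in_bigsetU (T : Type) (I : eqType) (s : seq I) (A : I -> set T) i x :
  i \in s -> A i x -> (\big[setU/set0]_(i <- s) A i) x.
Proof.
elim: s => // j s IH; rewrite inE big_cons => /predU1P[-> Aj|js Ai]; first by left.
by right; exact: IH.
Qed.

Section Constants.
Variable R : realType.

(** Everything follows from [K^3 ln H >= 8 / 2 = 4]: it gives [m >= 30 * 4], and it absorbs the cost
    of rounding up, at most 1, when 30 becomes 31. *)
Lemma m_len_bounds (K H : nat) : (2 <= K)%N -> (2 <= H)%N ->
  let m := m_len R K H in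
  [/\ (120 <= m)%N, 30 * K%:R ^+ 3 * ln H%:R <= m%:R :> R &
      m%:R <= 31 * K%:R ^+ 3 * ln H%:R :> R].
Proof.
move=> K2 H2 m; rewrite /m /m_len; set y := (_ * ln _ : R).
have L2 : 2^-1 <= ln H%:R :> R.
  apply: (le_trans (ln2_ge_half R)); rewrite ler_ln ?posrE ?ltr0n ?ler_nat//.
  by lia.
have K8 : 8 <= K%:R ^+ 3 :> R.
  have -> : 8 = 2 ^+ 3 :> R by ring.
  by rewrite ler_pXn2r ?nnegrE// ler_nat.
have y4 : 4 <= K%:R ^+ 3 * ln H%:R :> R.
  have -> : 4 = 8 * 2^-1 :> R by lra.
  by rewrite ler_pM.
have yE : y = 30 * (K%:R ^+ 3 * ln H%:R) by rewrite /y; ring.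
have y0 : 0 <= y by lra.
have cE : `|Num.ceil y|%N%:R = (Num.ceil y)%:~R :> R.
  by rewrite natr_absz ger0_norm// -(ler_int R) (le_trans y0)// ceil_ge.
have l1 : y <= `|Num.ceil y|%N%:R by rewrite cE ceil_ge.
have l2 : `|Num.ceil y|%N%:R <= y + 1.
  by rewrite cE ltW// -ltrBlDr -[X in _ - X]/(1%:~R) -intrB ceilB1_lt.
split => //.
- by rewrite -(ler_nat R); apply: le_trans l1; lra.
- have -> : 31 * K%:R ^+ 3 * ln H%:R = 31 * (K%:R ^+ 3 * ln H%:R) :> R by ring.
  lra.
Qed.

Lemma harmonic_ln (n : nat) : \sum_(i < n) ((2 + i)%:R)^-1 <= ln (n.+1)%:R :> R.
Proof.
elim: n => [|n IH]; first by rewrite big_ord0 ln1.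
rewrite big_ord_recr/=; apply: le_trans (lerD IH (lexx _)) _.
rewrite -lerBrDl -lerN2 opprB -ln_div ?posrE ?ltr0n//.
have -> : n.+1%:R / n.+2%:R = 1 - (2 + n)%:R^-1 :> R.
  rewrite add2n -[n.+2%:R]natr1; field.
  by rewrite gt_eqF//; have : 0 <= n%:R :> R by []; lra.
rewrite le_ln1Dx// ltrN2 invf_lt1 ?ltr0n// ltr1n.
by lia.
Qed.

End Constants.

Section Final.
Context (R : realType) (K H : nat) (d : measure_display) (T : measurableType d)
  (P : probability T R).
Variables (Rw : nat -> 'I_K -> T -> R) (W U : nat -> T -> R) (O : nat -> T -> 'I_K).
Variable inT : pred nat.
Hypothesis K2 : (2 <= K)%N.
Hypothesis H2 : (2 <= H)%N.
Hypothesis mRw : forall h k, measurable_fun setT (Rw h k).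
Hypothesis mW : forall h, measurable_fun setT (W h).
Hypothesis mU : forall h, measurable_fun setT (U h).
Hypothesis mO : forall h (S : {set 'I_K}), measurable [set x | O h x \in S].
Hypothesis Rw01 : forall h k x, 0 <= Rw h k x <= 1.
Hypothesis ident : forall h (B : 'I_K -> set R), (forall k, measurable (B k)) ->
     P (\bigcap_(k in [set: 'I_K]) (Rw h k @^-1` B k))
     = P (\bigcap_(k in [set: 'I_K]) (Rw 0%N k @^-1` B k)).
Hypothesis W_law : forall h (y : R), 0 <= y <= 1 ->
  P (W h @^-1` [set z | z < y]) = y%:E.
Hypothesis indep : independent_rounds P Rw W U O.

Let m := m_len R K H.
Let r := mean_rew P Rw.
Hypothesis opt_trusted : exists2 k, inT (nat_of_ord k) & r k = opt_rew r.

Lemma bad_event : exists Bad : set T, [/\ measurable Bad,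
  (P Bad <= (2 * K%:R / H%:R)%:E)%E &
  forall x, ~ Bad x -> good_trust K inT W m x /\ good_means H inT Rw W U O m r x].
Proof.
have [m120 mL _] := m_len_bounds R K2 H2.
have /choice[E hE] : forall j : 'I_K, exists E : set T,
    [/\ measurable E, (P E <= ((H%:R)^-1)%:E)%E &
    forall x, ~ E x -> accept j (prior_trusted inT j)
      (block_freq K m inT W (2 * m * j) x)
      (block_freq K m inT W (2 * m * j + m) x) = inT j].
  move=> j.
  exact: (block_decides mRw mW mU mO indep W_law inT K2 H2 m120 mL (ltn_ord j)).
pose D := @deviation R K H inT d T P Rw W U O m.
have mD w : measurable (D w).
  exact: deviation_measurable.
have mE j : measurable (E j) by have [] := hE j.
pose B1 := \big[setU/set0]_(j <- enum 'I_K) E j.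
pose B2 := \big[setU/set0]_(w <- enum {: 'I_H.+1 * 'I_H * 'I_K * bool}) D w.
have mB1 : measurable B1 by exact: bigsetU_measurable.
have mB2 : measurable B2 by exact: bigsetU_measurable.
have P1 := union_bound (enum 'I_K) mE (fun j => let: And3 _ h _ := hE j in h).
have P2 := union_bound (enum {: 'I_H.+1 * 'I_H * 'I_K * bool}) mD
  (deviation_prob inT mRw mW mU mO indep Rw01 ident m H2).
exists (B1 `|` B2); split; first exact: measurableU.
- apply: le_trans (measureU2 _ mB1 mB2) _.
  apply: le_trans (leeD P1 P2) _.
  rewrite -!cardE !card_prod !card_ord card_bool -EFinD lee_fin.
  have h2 : 2 <= H%:R :> R by rewrite ler_nat.
  have h0 : 0 < H%:R :> R by lra.
  have k0 : 0 <= K%:R :> R by [].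
  rewrite !natrM -natr1.
  (* The [K] tests use half of the budget [2 K / H]; the [2 K H (H + 1)] deviation events, each of
     probability at most [H^-8], must fit in the other half. *)
  suff : (H%:R + 1) * H%:R * K%:R * 2 * (H%:R ^+ 8)^-1 <= K%:R / H%:R :> R.
    by move=> ?; lra.
  rewrite ler_pdivrMr ?exprn_gt0//.
  have -> : K%:R / H%:R * H%:R ^+ 8 = K%:R * H%:R ^+ 7 :> R.
    by field; rewrite gt_eqF.
  have -> : (H%:R + 1) * H%:R * K%:R * 2 = K%:R * ((H%:R + 1) * H%:R * 2) :> R by ring.
  rewrite ler_wpM2l//.
  apply: (@le_trans _ _ (4 * H%:R ^+ 2)); first by rewrite expr2; nra.
  have -> : H%:R ^+ 7 = H%:R ^+ 5 * H%:R ^+ 2 :> R by ring.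
  rewrite ler_wpM2r ?sqr_ge0//.
  apply: (@le_trans _ _ (2 ^+ 5)); first by rewrite !exprS expr0; lra.
  by rewrite ler_pXn2r ?nnegrE// ltW.
- move=> x nB; split.
  + move=> j jK; have [_ _] := hE (Ordinal jK); apply => Ex.
    apply: nB; left; apply: (in_bigsetU _ Ex).
    by rewrite mem_enum.
  + apply: (good_means_off_deviation H2) => w Dw.
    by apply: nB; right; apply: (in_bigsetU _ Dw); rewrite mem_enum.
Qed.

Let q := ideal_trust R m K inT.
Let h0 := (2 * m * K)%N.
Let L : R := ln H%:R.

Lemma measurable_regret : measurable_fun setT
  (fun x => (regret_upto H inT Rw W U O r H x)%:E).
Proof.
apply/measurable_EFinP.
have md : dmeas (disc H inT Rw W U O H) by apply: dmeas_disc.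
rewrite (_ : regret_upto _ _ _ _ _ _ _ _ = fun x =>
  \sum_(e <- disc H inT Rw W U O H x) (opt_rew r - of_nat_arm r e.2)).
  exact: (measurable_bind (g := fun s _ => \sum_(e <- s) (opt_rew r - of_nat_arm r e.2)) md).
by apply/funext => x; rewrite /disc big_map.
Qed.

Lemma own_pulls_le : (\int[P]_x (\sum_(i < H) ((h0 <= i)%N && (q i <= W i x)%R)%:R)%:E
  <= ((1 + h0)%:R * (2 * L))%:E)%E.
Proof.
have mA (i : nat) : measurable [set x | q i <= W i x].
  by rewrite -[X in measurable X]setTI; exact: measurable_fun_le.
under eq_integral do rewrite -sumEFin.
rewrite ge0_integral_sum//; last first.
  move=> i; apply/measurable_EFinP.
  rewrite (_ : (fun x => _) = fun x => if (h0 <= i)%N then \1_[set x | q i <= W i x] x else 0).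
    by case: (h0 <= i)%N => //; exact: measurable_indic.
  apply/funext => x; case: (h0 <= i)%N => //=; rewrite indicE; congr ((nat_of_bool _)%:R).
  by apply/idP/idP; rewrite inE.
apply: (@le_trans _ _ (\sum_(i < H) ((1 + h0)%:R * ((2 + i)%:R)^-1)%:E)%E).
  apply: lee_sum => i _.
  have [hi|hi] := leqP h0 i; last first.
    under eq_integral do rewrite /=.
    by rewrite integral0 lee_fin mulr_ge0.
  rewrite (eq_integral (fun x => (\1_[set x | q i <= W i x] x)%:E)); last first.
    move=> x _; rewrite indicE /=; congr ((nat_of_bool _)%:R%:E).
    by apply/idP/idP; rewrite inE.
  rewrite (_ : (\int[P]_x _)%E = P [set x | q i <= W i x]); last first.
    by rewrite integral_indic// setIT.
  rewrite W_ge_law//; last exact: ideal_trust01.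
  by rewrite lee_fin; exact: ideal_trust_stage2.
rewrite sumEFin lee_fin -mulr_sumr ler_wpM2l//.
apply: le_trans (harmonic_ln R H) _.
have H0 : 0 < H%:R :> R by rewrite ltr0n; lia.
(* [H + 1 <= H^2] bounds the harmonic sum [ln (H + 1)] by [2 ln H]. *)
have -> : 2 * L = ln (H%:R ^+ 2) by rewrite lnXn// mulr_natl.
rewrite ler_ln ?posrE ?ltr0n ?exprn_gt0// -natrX ler_nat.
by rewrite expnS expn1; nia.
Qed.

Lemma expected_regret_le :
  (\int[P]_x (regret_upto H inT Rw W U O r H x)%:E <=
   (2 * K%:R + h0%:R + 12 * Num.sqrt (K%:R * H%:R * L)
    + (1 + h0)%:R * (2 * L))%:E)%E.
Proof.
have [Bad [mBad PBad hBad]] := bad_event.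
have [m120 _ _] := m_len_bounds R K2 H2.
have m0 : (0 < m)%N by apply: leq_trans m120.
have K0 : (0 < K)%N by exact: ltnW.
have H0 : 0 < H%:R :> R by rewrite ltr0n; lia.
have r01 k : 0 <= r k <= 1 by exact: mean_rew01.
pose c : R := h0%:R + 12 * Num.sqrt (K%:R * H%:R * L).
have c0 : 0 <= c by rewrite addr_ge0// mulr_ge0// sqrtr_ge0.
pose S x : R := \sum_(i < H) ((h0 <= i)%N && (q i <= W i x))%:R.
have S0 x : 0 <= S x by apply: sumr_ge0.
have mS : measurable_fun setT (fun x => (S x)%:E).
  apply/measurable_EFinP; apply: measurable_sum => i.
  rewrite (_ : (fun x => _) = fun x => if (h0 <= i)%N then \1_[set x | q i <= W i x] x else 0).
    case: (h0 <= i)%N => //; apply: measurable_indic.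
    by rewrite -[X in measurable X]setTI; exact: measurable_fun_le.
  apply/funext => x; case: (h0 <= i)%N => //=; rewrite indicE; congr ((nat_of_bool _)%:R).
  by apply/idP/idP; rewrite inE.
have mB : measurable_fun setT (fun x => (H%:R * \1_Bad x)%:E : \bar R).
  by apply/measurable_EFinP; exact: measurable_funM.
(* Domination on the whole space: the trivial bound [H] on the bad event, [c + S] elsewhere. The
   thresholds in [S] are deterministic, so its integral need not be restricted to the good event. *)
apply: (@le_trans _ _ (\int[P]_x ((H%:R * \1_Bad x)%:E + (c%:E + (S x)%:E)))%E).
  apply: ge0_le_integral => //.
  - by move=> x _; rewrite lee_fin regret_upto_ge0.
  - exact: measurable_regret.
  - apply: emeasurable_funD => //; exact: emeasurable_funD.
  - move=> x _; rewrite -!EFinD lee_fin indicE.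
    have [|nB] := boolP (x \in Bad).
      move=> _; rewrite mulr1; apply: le_trans (regret_upto_le _ _ _ _ _ _ r01 _ _) _.
      by rewrite lerDl addr_ge0.
    rewrite mulr0 add0r.
    have [gt gm] : good_trust K inT W m x /\ good_means H inT Rw W U O m r x.
      by apply: hBad => Bx; move/negP: nB; apply; rewrite inE.
    apply: le_trans (regret_good_final Rw01 H2 erefl m0 r01 K0 gt gm opt_trusted) _.
    by rewrite /c /S addrAC.
have mcS : measurable_fun setT (fun x => c%:E + (S x)%:E)%E.
  exact: emeasurable_funD.
have z1 x : (0 <= (H%:R * \1_Bad x)%:E :> \bar R)%E by rewrite lee_fin mulr_ge0.
have z2 x : (0 <= (S x)%:E :> \bar R)%E by rewrite lee_fin.
rewrite (ge0_integralD P measurableT (fun x _ => z1 x) mB _ mcS); last first.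
  by move=> x _; rewrite -EFinD lee_fin addr_ge0.
rewrite (ge0_integralD P measurableT _ _ (fun x _ => z2 x) mS)//.
have -> : (\int[P]_x c%:E = c%:E)%E.
  by rewrite integral_cst// -[RHS]mule1; congr (_ * _)%E; exact: probability_setT.
have -> : (\int[P]_x (H%:R * \1_Bad x)%:E = H%:R%:E * P Bad :> \bar R)%E.
  under eq_integral do rewrite EFinM.
  by rewrite ge0_integralZl// ?integral_indic// ?setIT//; exact/measurable_EFinP.
have -> : 2 * K%:R + h0%:R + 12 * Num.sqrt (K%:R * H%:R * L) + (1 + h0)%:R * (2 * L) =
  2 * K%:R + (c + (1 + h0)%:R * (2 * L)) by rewrite /c; ring.
rewrite [leRHS]EFinD; apply: leeD; last first.
  by rewrite [leRHS]EFinD; apply: leeD => //; exact: own_pulls_le.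
apply: le_trans (lee_wpmul2l _ PBad) _; first by rewrite lee_fin.
by rewrite -EFinM lee_fin mulrC divfK// gt_eqF.
Qed.

End Final.

Theorem theorem2 (R : realType) :
  exists C1 C2 : R, 0 < C1 /\ 0 < C2 /\
  forall (K H : nat), (2 <= K)%N -> (2 <= H)%N ->
  forall (d : measure_display) (T : measurableType d) (P : probability T R)
    (Rw : nat -> 'I_K -> T -> R)     (* reward vectors R_h(k) *)
    (W : nat -> T -> R)               (* uniform variables generating chi_h *)
    (O : nat -> T -> 'I_K)            (* implementer's own actions a_h^own *)
    (U : nat -> T -> R)               (* uniform tie-breaking variables *)
    (Tr : {set 'I_K}),                (* trust set *)
  (* measurability *)
  (forall h k, measurable_fun setT (Rw h k)) ->
  (forall h, measurable_fun setT (W h)) ->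
  (forall h, measurable_fun setT (U h)) ->
  (forall h (S : {set 'I_K}), measurable [set x | O h x \in S]) ->
  (* rewards in [0,1] *)
  (forall h k x, 0 <= Rw h k x <= 1) ->
  (* reward vectors identically distributed over time *)
  (forall h (B : 'I_K -> set R), (forall k, measurable (B k)) ->
     P (\bigcap_(k in [set: 'I_K]) (Rw h k @^-1` B k))
     = P (\bigcap_(k in [set: 'I_K]) (Rw 0%N k @^-1` B k))) ->
  (* uniform laws on [0,1] *)
  (forall h (y : R), 0 <= y <= 1 -> P (W h @^-1` [set z | z < y]) = y%:E) ->
  (forall h (y : R), 0 <= y <= 1 -> P (U h @^-1` [set z | z < y]) = y%:E) ->
  (* mutual independence of all the (R_h, W_h, O_h, U_h), h < n *)
  (forall (n : nat) (B : nat -> 'I_K -> set R) (BW BU : nat -> set R)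
          (S : nat -> {set 'I_K}),
     (forall h k, measurable (B h k)) -> (forall h, measurable (BW h)) ->
     (forall h, measurable (BU h)) ->
     fine (P (\bigcap_(h in [set h | (h < n)%N])
                ((\bigcap_(k in [set: 'I_K]) (Rw h k @^-1` B h k))
                 `&` (W h @^-1` BW h) `&` [set x | O h x \in S h]
                 `&` (U h @^-1` BU h))))
     = \prod_(h < n)
         (fine (P (\bigcap_(k in [set: 'I_K]) (Rw h k @^-1` B h k)))
          * fine (P (W h @^-1` BW h)) * fine (P [set x | O h x \in S h])
          * fine (P (U h @^-1` BU h)))) ->
  (* the trust set contains an optimal arm *)
  (exists2 k, k \in Tr & mean_rew P Rw k = opt_rew (mean_rew P Rw)) ->
  (\int[P]_x (tucb_regret P H Tr Rw W U O x)%:E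
   <= (C1 * Num.sqrt (K%:R * H%:R * ln (H%:R))
       + C2 * (K%:R) ^+ 4 * (ln (H%:R)) ^+ 2)%:E)%E.
Proof.
(* 12 is the confidence width 4 times the potential factor 3. With [z = K^4 ln^2 H], the other terms
   are at most [8 z] for [2 K], [124 z] for [h0 = 2 m K], [4 z] for [2 ln H] and [124 z] for
   [2 h0 ln H], which add up to [260 z]. *)
exists 12, 260; split; first by []; split; first by [].
move=> K H K2 H2 d T P Rw W O U Tr mRw mW mU mO Rw01 ident W_law _ indep [k0 k0T k0r].
pose inT (a : nat) := [exists k : 'I_K, (k \in Tr) && (nat_of_ord k == a)].
have opt : exists2 k, inT (nat_of_ord k) &
    mean_rew P Rw k = opt_rew (mean_rew P Rw).
  by exists k0 => //; apply/existsP; exists k0; rewrite k0T eqxx.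
(* [tucb_regret] and [regret_upto] agree by conversion. *)
apply: le_trans (expected_regret_le K2 H2 mRw mW mU mO Rw01 ident W_law indep opt) _.
have [_ _ mle] := m_len_bounds R K2 H2.
rewrite lee_fin !natrD !natrM.
have L2 : 2^-1 <= ln H%:R :> R.
  apply: (le_trans (ln2_ge_half R)); rewrite ler_ln ?posrE ?ltr0n ?ler_nat//.
  by lia.
have K2' : 2 <= K%:R :> R by rewrite ler_nat.
set s : R := Num.sqrt (_ * _); move: s.
move: ((m_len R K H)%:R : R) (ln H%:R : R) L2 K2' mle => m L L2.
move: (K%:R : R) => k k2 mle s.
have k3 : 1 <= k ^+ 3 by rewrite exprn_ege1//; lra.
have k4 : k <= k ^+ 4.
  by rewrite exprS ler_peMr//; lra.
have k41 : 1 <= k ^+ 4 by lra.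
have h0 : 2 * m * k <= 62 * (k ^+ 4 * L).
  have -> : 62 * (k ^+ 4 * L) = 2 * (31 * k ^+ 3 * L) * k by ring.
  by rewrite ler_wpM2r ?ler_wpM2l//; lra.
have L22 : L <= 2 * L ^+ 2 by rewrite expr2; nra.
have e1 : k ^+ 4 * L <= 2 * (k ^+ 4 * L ^+ 2).
  by rewrite mulrCA ler_wpM2l//; lra.
have e2 : k <= 4 * (k ^+ 4 * L ^+ 2).
  have : k ^+ 4 * 1 <= k ^+ 4 * (4 * L ^+ 2) by rewrite ler_wpM2l//; nra.
  by lra.
have e3 : L <= 2 * (k ^+ 4 * L ^+ 2).
  have : 1 * L ^+ 2 <= k ^+ 4 * L ^+ 2 by rewrite ler_wpM2r// sqr_ge0.
  by lra.
have e4 : (2 * m * k) * (2 * L) <= 124 * (k ^+ 4 * L ^+ 2).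
  have := ler_wpM2r (_ : 0 <= 2 * L) h0.
  rewrite (_ : 62 * _ * _ = 124 * (k ^+ 4 * L ^+ 2)).
    by apply; lra.
  by ring.
have -> : 260 * k ^+ 4 * L ^+ 2 = 260 * (k ^+ 4 * L ^+ 2) by ring.
have -> : (1 + 2 * m * k) * (2 * L) = 2 * L + 2 * m * k * (2 * L) by ring.
move: (k ^+ 4 * L ^+ 2) (k ^+ 4 * L) (2 * m * k) h0 e1 e2 e3 e4 => z y n h0 e1 e2 e3.
move: (n * (2 * L)) => v e4; lra.
Qed.
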